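(* Let $g:\mathbb{R}\to\mathbb{R}$ be an admissible kernel with local constants $\varepsilon,\beta>0$. Then there is a constant $\nu_0>\max\{\varepsilon,\beta\}$, depending only on the kernel $g$ and the constants $\varepsilon,\beta$, such that the following holds for every $\nu\ge\nu_0$. Let $\sigma>0$, $N>0$, $\delta\ge 0$, and set $g_\sigma[k]:=g\left(\frac{k}{\sigma N}\right)$ for $k\in\mathbb{Z}$ and $\gamma:=\max\{N\sigma,\varepsilon^{-1}\}$. Let $K=\{k_m\}\subset\mathbb{Z}$ (the $k_m$ being distinct) satisfy the separation condition $$\min_{k_i,k_j\in K,\ i\ne j}|k_i-k_j|\ \ge\ N\nu\sigma ,$$ let $x[k]=\sum_m c_m\,\delta[k-k_m]$ be a signal in $\ell_1(\mathbb{Z})$ with nonzero real weights $c_m$ (where $\delta[\cdot]$ is the Kronecker delta), and let $$y[k]=\sum_m c_m\,g_\sigma[k-k_m]+\eta[k],\qquad k\in\mathbb{Z},$$ where $\eta:\mathbb{Z}\to\mathbb{R}$ satisfies $\|\eta\|_1=\sum_{k}|\eta[k]|\le\delta$. Let $\hat x$ be a solution of the convex program $$\min_{\tilde x\in\ell_1(\mathbb{Z})}\|\tilde x\|_1\quad\text{subject to}\quad \|y-g_\sigma\ast\tilde x\|_1\le\delta ,$$ and let $\hat K:=\{k\in\mathbb{Z}:\hat x[k]\neq 0\}$ be its support. Then for every $m$ such that $|c_m|>\frac{16\gamma^2}{\beta}\delta$ there exists $\hat k_m\in\hat K$ such that $$\left|k_m-\hat k_m\right|\ \le\ \frac{8\gamma^2}{\beta}\sqrt{\frac{g(0)\,\delta}{|c_m|-\frac{16\gamma^2}{\beta}\delta}}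 .$$
   Context: Admissible kernel: a function $g:\mathbb{R}\to\mathbb{R}$ is admissible (with local constants $\varepsilon,\beta>0$) if: 1. $g\in\mathcal{C}^3(\mathbb{R})$, and $g$ is real and even. 2. (Global property) There are constants $C_\ell>0$, $\ell=0,1,2,3$, such that $|g^{(\ell)}(t)|\le C_\ell/(1+t^2)$ for all $t\in\mathbb{R}$, where $g^{(\ell)}$ is the $\ell$-th derivative of $g$. 3. (Local property) The constants $\varepsilon,\beta>0$ are such that (a) $g(t)>0$ for all $|t|\le\varepsilon$ and $g(t)<g(\varepsilon)$ for all $|t|>\varepsilon$; (b) $g^{(2)}(t)<-\beta$ for all $|t|\le\varepsilon$. It is also required that $\varepsilon,\beta<\nu$, where $\nu$ is the separation constant. Discrete convolution: $(g_\sigma\ast\tilde x)[k]=\sum_{j\in\mathbb{Z}}g_\sigma[k-j]\,\tilde x[j]$. The norm $\|\cdot\|_1$ is the $\ell_1(\mathbb{Z})$ norm. *)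

(* Defs.v *)
From HB Require Import structures.
From mathcomp Require Import all_boot all_order all_algebra.
From mathcomp Require Import all_classical all_reals all_analysis.

Set Implicit Arguments.
Unset Strict Implicit.
Unset Printing Implicit Defensive.
Import Order.TTheory GRing.Theory Num.Theory.
Import numFieldNormedType.Exports.
Local Open Scope classical_set_scope.
Local Open Scope ring_scope.

(* Since [g^`(l)] is a total operation, derivability is required explicitly. *)
Definition C3 (R : realType) (g : R -> R) : Prop :=
  (forall (l : nat) (t : R), (l < 3)%N -> derivable (g^`(l)%classic) t 1) /\
  continuous (g^`(3)%classic).

Record admissible (R : realType) (g : R -> R) (eps beta : R) : Prop :=
  Admissible {
    admissible_eps_gt0 : 0 < eps;
    admissible_beta_gt0 : 0 < beta;
    admissible_C3 : C3 g;
    admissible_even : forall t, g (- t) = g t;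
    admissible_decay : forall l : nat, (l <= 3)%N ->
      exists2 C : R, 0 < C & forall t, `|g^`(l)%classic t| <= C / (1 + t ^+ 2);
    admissible_pos : forall t, `|t| <= eps -> 0 < g t;
    admissible_far : forall t, eps < `|t| -> g t < g eps;
    admissible_concave : forall t, `|t| <= eps -> g^`(2)%classic t < - beta }.

(* Sum of an absolutely summable real family: [esum] is only meaningful on
   nonnegative families, so positive and negative parts are summed apart. *)
Definition rsum (R : realType) (T : choiceType) (f : T -> R) : R :=
  fine (\esum_(i in [set: T]) (Num.max (f i) 0)%:E) -
  fine (\esum_(i in [set: T]) (Num.max (- f i) 0)%:E).

Definition l1norm (R : realType) (x : int -> R) : \bar R :=
  \esum_(k in [set: int]) `|x k|%:E.

Definition in_l1 (R : realType) (x : int -> R) : Prop :=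
  summable [set: int] (EFin \o x).

Definition conv (R : realType) (h x : int -> R) (k : int) : R :=
  rsum (fun j : int => h (k - j) * x j).

Definition sampled (R : realType) (g : R -> R) (sigma N : R) (k : int) : R :=
  g (k%:~R / (sigma * N)).

Definition kronecker (R : realType) (k : int) : R := (k == 0)%:R.

Definition spikes (R : realType) (I : choiceType) (node : I -> int)
    (c : I -> R) (k : int) : R :=
  rsum (fun m : I => c m * kronecker R (k - node m)).

Definition measurements (R : realType) (g : R -> R) (sigma N : R)
    (I : choiceType) (node : I -> int) (c : I -> R) (eta : int -> R)
    (k : int) : R :=
  rsum (fun m : I => c m * sampled g sigma N (k - node m)) + eta k.

Definition feasible (R : realType) (h y : int -> R) (delta : R)
    (x : int -> R) : Prop :=
  in_l1 x /\ (l1norm (fun k => (y k - conv h x k)%R) <= delta%:E)%E.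

Definition l1_solution (R : realType) (h y : int -> R) (delta : R)
    (xhat : int -> R) : Prop :=
  feasible h y delta xhat /\
  forall x : int -> R, feasible h y delta x -> (l1norm xhat <= l1norm x)%E.

Definition supp (R : realType) (x : int -> R) : set int :=
  [set k | x k != 0].

(* Main.v *)
Require Import Defs.
From HB Require Import structures.
From mathcomp Require Import all_boot all_order all_algebra.
From mathcomp Require Import all_classical all_reals all_analysis.
From mathcomp Require Import finmap ring lra.
Import Order.TTheory GRing.Theory Num.Theory.
Import numFieldNormedType.Exports.
Local Open Scope classical_set_scope.
Local Open Scope ring_scope.

Set Implicit Arguments.
Unset Strict Implicit.
Unset Printing Implicit Defensive.

(* The nearby support point is the spike location itself: every spike [k0] with
   [|x k0| > threshold] lies in the support of [xhat].

   Suppose [xhat k0 = 0], and let [z = xhat - x], [A = G 0],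
   [rho = beta / (6 gamma^2)]. On a finite set [F] of spikes carrying almost all
   the mass of [x], solving a diagonally dominant system for the amplitudes gives
     W u = sum_l a_l G (u - t_l) + sum_l b_l H (u - t_l)
   with [W = A sgn z] on [F] and [|W| <= A - rho] at the other grid points; then
     W z + (A - rho) (|xhat| - |x|) >= rho |x k0| 1_{k0} - 2 (A - rho) |x| 1_{F^c}
   pointwise. Summed over the grid, the left-hand side is at most
   [(5/2) delta]: [|xhat|_1 <= |x|_1], and as [G] and [H] are combinations of
   grid translates of [g], [sum W z] is a combination of values of [g * z], where
   [|g * z|_1 <= 2 delta]. The mass of [x] off [F] being arbitrarily small,
   [rho |x k0| <= (5/2) delta], which contradicts the threshold.

   The usual choice [G = g] fails when [g] has deep negative lobes, which
   admissibility allows since it bounds [g], not [|g|], away from [0]. If [tau]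
   minimizes [g] on the grid, [G = g - (g (. + tau) + g (. - tau)) / 2] has its
   strict maximum modulus over the grid at [0] whatever the depth of the lobes.
   The odd pulse [H], a difference of two grid translates at distance at most
   [eps], makes [W' = 0] on [F]. It is not needed on a grid of mesh [> eps],
   where no grid point but the spike itself lies in the zone [|t - t_l| <= eps]
   in which [W] is controlled to second order. *)

(** * Diagonally dominant systems and sums over separated points *)

(** At an index where [|x i|] is maximal, the off-diagonal terms cost at most the off-diagonal row
    sum times [|x i|], so dominance leaves [d * |x i|] in that row. *)
Lemma diag_dominant_bound (R : realFieldType) (J : finType) (M : J -> J -> R)
    (d B : R) (x : J -> R) :
  0 < d -> (forall i, d + \sum_(j | j != i) `|M i j| <= `|M i i|) ->
  (forall i, `|\sum_j M i j * x j| <= B) -> forall i, `|x i| <= B / d.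
Proof.
move=> d0 dom Mx i0.
have [i imax] : exists i, forall j, `|x j| <= `|x i|.
  have [i _ imax] := Order.TotalTheory.arg_maxP (fun i => `|x i|) (erefl : xpredT i0).
  by exists i => j; exact: imax.
apply: le_trans (imax i0) _; rewrite ler_pdivlMr//.
apply: le_trans (Mx i); rewrite (bigD1 i)//=.
apply: le_trans (lerB_normD _ _).
have : `|\sum_(j | j != i) M i j * x j| <= (\sum_(j | j != i) `|M i j|) * `|x i|.
  rewrite mulr_suml; apply: le_trans (ler_norm_sum _ _ _) _.
  by apply: ler_sum => j _; rewrite normrM ler_wpM2l// imax.
have := ler_wpM2r (normr_ge0 (x i)) (dom i).
rewrite normrM mulrDl; lra.
Qed.

(** The preceding bound with [B = 0] makes the square system injective, hence invertible. *)
Lemma diag_dominant_solve (R : realFieldType) (J : finType) (M : J -> J -> R)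
    (d : R) (y : J -> R) :
  0 < d -> (forall i, d + \sum_(j | j != i) `|M i j| <= `|M i i|) ->
  exists x : J -> R, forall i, \sum_j M i j * x j = y i.
Proof.
move=> d0 dom.
(* Row vectors act from the left, hence the transposed indices. *)
pose A := \matrix_(i < #|J|, j < #|J|) M (enum_val j) (enum_val i).
have mulA (v : 'rV_#|J|) (i : J) :
    (v *m A) 0 (enum_rank i) = \sum_j M i j * v 0 (enum_rank j).
  rewrite mxE (reindex enum_rank) /=; last first.
    by exists enum_val => j _; rewrite ?enum_rankK ?enum_valK.
  by apply: eq_bigr => j _; rewrite mxE !enum_rankK mulrC.
have Afree : row_free A.
  apply: inj_row_free => v vA0; apply/rowP => k; rewrite [RHS]mxE.
  have := @diag_dominant_bound _ _ _ _ 0 (fun j => v 0 (enum_rank j)) d0 dom.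
  move=> /(_ _ (enum_val k)); rewrite enum_valK mul0r normr_le0 => H.
  by apply/eqP/H => i; rewrite -mulA vA0 mxE normr0.
exists (fun j => ((\row_k y (enum_val k)) *m invmx A) 0 (enum_rank j)) => i.
by rewrite -mulA mulmxKV -?row_free_unit// mxE enum_rankK.
Qed.

Lemma sum_inv_sqr_le2 (R : realFieldType) (n : nat) :
  \sum_(i < n) (i.+1%:R ^+ 2)^-1 <= 2 :> R.
Proof.
case: n => [|n]; first by rewrite big_ord0.
(* The sharper bound, with [1 / (n + 1)] subtracted, is the one that passes through the
   induction. *)
suff H : \sum_(i < n.+1) (i.+1%:R ^+ 2)^-1 <= 2 - n.+1%:R^-1 :> R.
  by apply: le_trans H _; rewrite gerBl.
elim: n => [|n IH]; first by rewrite big_ord1 expr1n invr1; lra.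
rewrite big_ord_recr/=; apply: le_trans (lerD IH (lexx _)) _.
set m := n.+1%:R : R.
have m0 : 0 < m by rewrite ltr0n.
have -> : n.+2%:R = m + 1 :> R by rewrite /m -natr1.
rewrite -subr_ge0.
have -> : 2 - (m + 1)^-1 - (2 - m^-1 + ((m + 1) ^+ 2)^-1) = (m * (m + 1) ^+ 2)^-1.
  by field; lra.
by rewrite invr_ge0 mulr_ge0 ?sqr_ge0// ltW.
Qed.

Lemma sum_inj_le (R : realFieldType) (J : finType) (P : pred J) (n : J -> nat)
    (w : nat -> R) (B : R) :
  (forall k, 0 <= w k) -> {in P &, injective n} ->
  (forall N, \sum_(k < N) w k <= B) -> \sum_(i | P i) w (n i) <= B.
Proof.
move=> w0 ninj wB; set N := (\max_(i : J) n i).+1.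
apply: le_trans (wB N).
have -> : \sum_(i | P i) w (n i) = \sum_(i | P i) \sum_(k < N | k == n i :> nat) w k.
  apply: eq_bigr => i _.
  have ni : (n i < N)%N by rewrite ltnS leq_bigmax.
  by rewrite (big_pred1 (Ordinal ni)).
rewrite (exchange_big_dep xpredT)//=; apply: ler_sum => k _.
rewrite sumr_const -mulr_natl ler_piMl// (ler_nat _ _ 1).
rewrite leqNgt; apply/negP => /card_gt1P[i [j [+ + /negP]]].
rewrite !unfold_in => /andP[Pi /eqP ki] /andP[Pj /eqP kj]; apply.
by rewrite (ninj i j)// -ki -kj.
Qed.

(** Bins of width [nu] by distance to [u]: on one side of [u], separated points fall into distinct
    bins. A point of bin [n] is at distance at least [(n + 1) * nu / 2], by [far] when [n = 0]. Each
    side thus contributes at most [4 / nu ^+ 2] times the sum of inverse squares, that is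
    [8 / nu ^+ 2]. *)
Lemma separated_sum_le (R : realType) (J : finType) (t : J -> R) (nu u : R)
    (P : pred J) :
  0 < nu -> (forall i j, i != j -> nu <= `|t i - t j|) ->
  (forall i, P i -> nu / 2 <= `|u - t i|) ->
  \sum_(i | P i) (1 + (u - t i) ^+ 2)^-1 <= 16 / nu ^+ 2.
Proof.
move=> nu0 sep far.
pose n i := Num.truncn (`|u - t i| / nu).
have le1 i : P i -> (1 + (u - t i) ^+ 2)^-1 <= 4 / nu ^+ 2 * ((n i).+1%:R ^+ 2)^-1.
  move=> Pi; have := far i Pi; set x := `|u - t i| => xnu.
  have : (n i)%:R <= x / nu by rewrite truncn_le divr_ge0// ltW.
  rewrite ler_pdivlMr// => nx.
  have hx : (n i).+1%:R * nu <= 2 * x.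
    rewrite -natr1; case: (n i) nx => [|k] nx; first by lra.
    have : nu <= k.+1%:R * nu by rewrite ler_peMl ?ler1n// ltW.
    lra.
  rewrite -[(u - t i) ^+ 2]real_normK ?num_real// -/x.
  have m0 : 0 < (n i).+1%:R :> R by rewrite ltr0n.
  move: (_ %:R) m0 hx => m m0 hx.
  have -> : 4 / nu ^+ 2 * (m ^+ 2)^-1 = ((m * nu / 2) ^+ 2)^-1.
    by field; rewrite !gt_eqF.
  have p0 : 0 < m * nu / 2 by rewrite divr_gt0// mulr_gt0.
  have x0 : 0 <= x by exact: normr_ge0.
  rewrite lef_pV2 ?posrE ?exprn_gt0//; last by rewrite ltr_pwDl// sqr_ge0.
  have : (m * nu / 2) ^+ 2 <= x ^+ 2 by rewrite ler_sqr ?nnegrE ?(ltW p0)//; lra.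
  lra.
apply: le_trans (ler_sum _ le1) _; rewrite -mulr_sumr.
(* The hypothesis on [Q] says that its points lie on one side of [u], so that distances to [u] are
   as far apart as the points themselves. *)
have inj (Q : pred J) : (forall i j, Q i -> Q j -> `|t i - t j| = `| `|u - t i| - `|u - t j| |) ->
    {in Q &, injective n}.
  move=> same i j Qi Qj nij; apply/eqP; apply: contraT => /sep; rewrite same//.
  have itv k : (n k)%:R * nu <= `|u - t k| < (n k)%:R * nu + nu.
    have /andP[] := truncn_itv (divr_ge0 (normr_ge0 (u - t k)) (ltW nu0)).
    rewrite -/(n k) ler_pdivlMr// ltr_pdivrMr// -natr1 mulrDl mul1r => -> ->.
    by [].
  have /andP[ai bi] := itv i; have /andP[aj bj] := itv j; rewrite nij in ai bi.
  by rewrite leNgt ltr_norml => /negP; case; apply/andP; split; lra.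
have half (Q : pred J) : (forall i j, Q i -> Q j -> `|t i - t j| = `| `|u - t i| - `|u - t j| |) ->
    \sum_(i | Q i) ((n i).+1%:R ^+ 2)^-1 <= 2 :> R.
  move=> /inj ninj; apply: (@sum_inj_le _ _ _ n (fun k => (k.+1%:R ^+ 2)^-1)) => //.
  exact: sum_inv_sqr_le2.
rewrite (bigID (fun i => t i <= u))/=.
have -> : 16 / nu ^+ 2 = 4 / nu ^+ 2 * (2 + 2) by field; rewrite gt_eqF.
rewrite ler_wpM2l ?divr_ge0 ?sqr_ge0// lerD// half// => i j /andP[_ ti] /andP[_ tj].
  rewrite (ger0_norm (_ : 0 <= u - t i)) ?subr_ge0//.
  by rewrite (ger0_norm (_ : 0 <= u - t j)) ?subr_ge0// distrC; congr `|_|; lra.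
rewrite -!ltNge in ti tj.
rewrite (ltr0_norm (_ : u - t i < 0)) ?subr_lt0//.
by rewrite (ltr0_norm (_ : u - t j < 0)) ?subr_lt0//; congr `|_|; lra.
Qed.

(** * Interpolation by decaying pulses *)

Definition decay (R : realType) (C : R) (f : R -> R) : Prop :=
  forall t, `|f t| <= C / (1 + t ^+ 2).

Lemma decay_bound (R : realType) (C : R) (f : R -> R) (t : R) :
  0 <= C -> decay C f -> `|f t| <= C.
Proof.
move=> C0 /(_ t) /le_trans; apply.
by rewrite ler_pdivrMr ?ltr_pwDl ?sqr_ge0// ler_peMr// lerDl sqr_ge0.
Qed.

Lemma separated_decay_le (R : realType) (J : finType) (t : J -> R)
    (nu u C : R) (P : pred J) (f : R -> R) :
  0 < nu -> 0 <= C -> (forall i j, i != j -> nu <= `|t i - t j|) ->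
  (forall i, P i -> nu / 2 <= `|u - t i|) -> decay C f ->
  \sum_(i | P i) `|f (u - t i)| <= C * (16 / nu ^+ 2).
Proof.
move=> nu0 C0 sep far fC.
apply: le_trans (ler_sum _ (fun i _ => fC (u - t i))) _.
by rewrite -mulr_sumr ler_wpM2l// separated_sum_le.
Qed.

Lemma separated_combination_le (R : realType) (J : finType) (t : J -> R)
    (nu u C B : R) (P : pred J) (f : R -> R) (a : J -> R) :
  0 < nu -> 0 <= C -> (forall i j, i != j -> nu <= `|t i - t j|) ->
  (forall i, P i -> nu / 2 <= `|u - t i|) -> decay C f ->
  0 <= B -> (forall i, `|a i| <= B) ->
  `|\sum_(i | P i) a i * f (u - t i)| <= B * (C * (16 / nu ^+ 2)).
Proof.
move=> nu0 C0 sep far fC B0 aB.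
apply: le_trans (ler_norm_sum _ _ _) _.
apply: (@le_trans _ _ (\sum_(i | P i) B * `|f (u - t i)|)).
  by apply: ler_sum => i _; rewrite normrM ler_wpM2r.
by rewrite -mulr_sumr ler_wpM2l//; apply: separated_decay_le.
Qed.

(** Both families of unknowns form one system. Since [H 0 = D 0 = 0], the block coupling a node with
    itself is diagonal, with entries at least [d]; the rest of a row sums to at most
    [2 * e <= d / 2]. Dominance bounds every unknown by [C / (d / 2)], and feeding this back into
    the off-diagonal part yields the deviation [kappa] of [a] from [s] and of [b] from [0]. *)
Lemma interpolation (R : realType) (J : finType) (t : J -> R) (nu C d : R)
    (G H D E : R -> R) (s : J -> R) :
  0 < nu -> 0 <= C -> 0 < d -> (forall i j, i != j -> nu <= `|t i - t j|) ->
  decay C G -> decay C H -> decay C D -> decay C E ->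
  H 0 = 0 -> D 0 = 0 -> d <= G 0 -> d <= E 0 ->
  4 * (C * (16 / nu ^+ 2)) <= d -> (forall i, `|s i| <= 1) ->
  let kappa := 4 * C / d ^+ 2 * (C * (16 / nu ^+ 2)) in
  exists a b : J -> R,
    [/\ forall m, \sum_l a l * G (t m - t l) + \sum_l b l * H (t m - t l) = s m * G 0,
        forall m, \sum_l a l * D (t m - t l) + \sum_l b l * E (t m - t l) = 0,
        forall m, `|a m - s m| <= kappa & forall m, `|b m| <= kappa].
Proof.
move=> nu0 C0 d0 sep GC HC DC EC H0 D0 Gd Ed nud s1 kappa.
set e := C * _ in nud kappa *.
have e0 : 0 <= e by rewrite mulr_ge0// divr_ge0// sqr_ge0.
(* The first flag selects the equation (value or slope), the second the unknown ([a] or [b]). *)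
pose F (p q : bool) := if p then if q then E else D else if q then H else G.
have FC p q : decay C (F p q) by case: p; case: q.
pose M (p q : J * bool) := F p.2 q.2 (t p.1 - t q.1).
have far m i : i != m -> nu / 2 <= `|t m - t i|.
  by move=> im; apply: le_trans (sep m i _); [lra|rewrite eq_sym].
have offdiag p : \sum_(q | q != p) `|M p q| <= 2 * e.
  have -> : \sum_(q | q != p) `|M p q| =
      \sum_(l | l != p.1) `|F p.2 true (t p.1 - t l)| +
      \sum_(l | l != p.1) `|F p.2 false (t p.1 - t l)|.
    apply: (@addrI _ `|M p p|); rewrite -(bigD1 p (P := xpredT))//=.
    rewrite -(pair_bigA _ (fun l q => `|M p (l, q)|))/=.
    under eq_bigr do rewrite big_bool /=.
    rewrite (bigD1 p.1)//= big_split/=; congr +%R.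
    by case: p => m []; rewrite /M /F/= subrr ?H0 ?D0 normr0 ?addr0 ?add0r.
  by rewrite mulr_natl mulr2n lerD// separated_decay_le// => i; exact: far.
have diag p : d <= M p p by case: p => m []; rewrite /M/= subrr.
have dom p : d / 2 + \sum_(q | q != p) `|M p q| <= `|M p p|.
  have := offdiag p; have := diag p; have := ler_norm (M p p).
  by move: (\sum_(q | q != p) _) => S; lra.
have d20 : 0 < d / 2 by rewrite divr_gt0.
have [x Mx] := diag_dominant_solve (fun p => if p.2 then 0 else s p.1 * G 0) d20 dom.
have xB : forall p, `|x p| <= C / (d / 2).
  apply: (diag_dominant_bound d20 dom) => p; rewrite Mx.
  case: p.2; first by rewrite normr0.
  rewrite normrM -[C]mul1r ler_pM//; exact: decay_bound.
have rest p : `|\sum_(q | q != p) M p q * x q| <= 2 * e * (C / (d / 2)).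
  apply: le_trans (ler_norm_sum _ _ _) _.
  apply: le_trans (ler_wpM2r _ (offdiag p)); last by rewrite divr_ge0// ltW.
  by rewrite mulr_suml; apply: ler_sum => q _; rewrite normrM ler_wpM2l.
have kappaE : kappa * d = 2 * e * (C / (d / 2)) by rewrite /kappa; field; rewrite gt_eqF.
have close p z : `|M p p * z| <= 2 * e * (C / (d / 2)) -> `|z| <= kappa.
  rewrite normrM -kappaE => h; rewrite -(ler_pM2r d0); apply: le_trans h.
  by rewrite mulrC ler_wpM2r// (le_trans (diag p))// ler_norm.
have rowE m (q : bool) : \sum_l x (l, false) * F q false (t m - t l) +
    \sum_l x (l, true) * F q true (t m - t l) = if q then 0 else s m * G 0.
  rewrite -(Mx (m, q)).
  rewrite (eq_bigr (fun p => M (m, q) (p.1, p.2) * x (p.1, p.2))); last by case.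
  rewrite -(pair_bigA _ (fun l r => M (m, q) (l, r) * x (l, r)))/=.
  rewrite -big_split; apply: eq_bigr => l _; rewrite big_bool/= addrC.
  by rewrite /M/=; congr +%R; rewrite mulrC.
exists (fun l => x (l, false)), (fun l => x (l, true)); split=> m.
- exact: rowE m false.
- exact: rowE m true.
- apply: (close (m, false)).
  have -> : M (m, false) (m, false) * (x (m, false) - s m) =
      - \sum_(q | q != (m, false)) M (m, false) q * x q.
    have := Mx (m, false); rewrite (bigD1 (m, false))//= => Mxm.
    by rewrite mulrBr /M/= subrr mulrC [G 0 * s m]mulrC -Mxm /M/= subrr; ring.
  by rewrite normrN; exact: rest.
- apply: (close (m, true)).
  have -> : M (m, true) (m, true) * x (m, true) =
      - \sum_(q | q != (m, true)) M (m, true) q * x q.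
    by have := Mx (m, true); rewrite (bigD1 (m, true))//= => /eqP; rewrite addr_eq0 => /eqP.
  by rewrite normrN; exact: rest.
Qed.

(** * Taylor bounds and the dual certificate *)

Definition has_derive1 (R : realType) (f f1 : R -> R) : Prop :=
  forall x : R, is_derive x (1 : R) f (f1 x).

Lemma has_derive1_continuous (R : realType) (f f1 : R -> R) :
  has_derive1 f f1 -> continuous f.
Proof.
by move=> df y; apply: differentiable_continuous; apply/derivable1_diffP; case: (df y).
Qed.

Lemma has_derive1_le_right (R : realType) (f f1 : R -> R) (K r : R) :
  has_derive1 f f1 -> (forall x : R, 0 <= x <= r -> f1 x <= K) ->
  forall x : R, 0 <= x <= r -> f x <= f 0 + K * x.
Proof.
move=> df f1K x /andP[x0 xr].
have fc : {within `[0, x], continuous f}.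
  exact/continuous_subspaceT/(has_derive1_continuous df).
have [c] := MVT_segment x0 (fun z _ => df z) fc.
rewrite in_itv/= !subr0 => /andP[c0 cx] fE.
by rewrite -lerBlDl fE ler_wpM2r// f1K// c0 (le_trans cx).
Qed.

Lemma taylor2_right (R : realType) (f f1 f2 : R -> R) (K r : R) :
  has_derive1 f f1 -> has_derive1 f1 f2 ->
  f1 0 = 0 -> (forall x : R, 0 <= x <= r -> f2 x <= K) ->
  forall x : R, 0 <= x <= r -> f x <= f 0 + K / 2 * x ^+ 2.
Proof.
move=> df df1 f10 f2K x /andP[x0 xr].
pose g := f - (K / 2) \*: (fun y => y ^+ 2 : R).
have dg (y : R) : is_derive y (1 : R) g (f1 y - K * y).
  have -> : f1 y - K * y = f1 y - (K / 2) *: (2%:R * y ^+ 1 *: 1) :> R.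
    by rewrite /GRing.scale/=; field.
  apply: is_deriveB; first exact: df.
  apply: is_deriveZ.
  exact: (@is_deriveX _ _ id 2 y 1 1 (is_derive_id _ _)).
have gE y : g y = f y - K / 2 * y ^+ 2 by [].
have := @has_derive1_le_right _ g _ 0 r dg _ x; rewrite !gE x0 xr expr0n/= => H.
suff /H : forall y : R, 0 <= y <= r -> f1 y - K * y <= 0 by move=> /(_ isT); lra.
move=> y yr; have := has_derive1_le_right df1 f2K yr; rewrite f10; lra.
Qed.

Lemma taylor2_le (R : realType) (f f1 f2 : R -> R) (c K r : R) :
  has_derive1 f f1 -> has_derive1 f1 f2 ->
  f1 c = 0 -> (forall x, `|x - c| <= r -> f2 x <= K) ->
  forall x, `|x - c| <= r -> f x <= f c + K / 2 * (x - c) ^+ 2.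
Proof.
move=> df df1 f1c f2K x xr.
have dcomp (g dg : R -> R) (w : R) : has_derive1 g dg ->
    has_derive1 (fun y => g (c + w * y)) (fun y => w * dg (c + w * y)).
  move=> dg' y; rewrite mulrC; apply: (@is_derive1_comp _ g (fun y => c + w * y)); first exact: dg'.
  have : is_derive y (1 : R) (cst c + (w \*: (@id R))) (0 + w *: 1) by exact: is_deriveD.
  by rewrite add0r [_ *: _]mulr1.
(* [w] is the sign of [x - c]; composing with [c + w * y] reduces both sides of [c] to the one-sided
   bound. *)
suff H w : w ^+ 2 = 1 -> 0 <= w * (x - c) -> f x <= f c + K / 2 * (x - c) ^+ 2.
  case: (leP c x) => cx; first by apply: (H 1); rewrite ?expr1n// mul1r subr_ge0.
  by apply: (H (-1)); rewrite ?sqrrN ?expr1n// mulN1r oppr_ge0 subr_le0 ltW.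
move=> w2 wx.
have wE y : c + w * (w * y) = c + y by rewrite mulrA -expr2 w2 mul1r.
have absw y : `|w * y| = `|y|.
  rewrite normrM; have : `|w| ^+ 2 = 1 by rewrite real_normK ?num_real.
  by move=> /eqP; rewrite sqrp_eq1// => /eqP ->; rewrite mul1r.
have := @taylor2_right _ (fun y => f (c + w * y)) (fun y => w * f1 (c + w * y))
  (fun y => w * (w * f2 (c + w * y))) K r (dcomp _ _ w df).
have df1' : has_derive1 (fun y => w * f1 (c + w * y)) (fun y => w * (w * f2 (c + w * y))).
  by move=> y; apply: (@is_deriveZ _ _ _ (fun y => f1 (c + w * y)) w); exact: dcomp.
move=> /(_ df1'); rewrite mulr0 addr0 f1c mulr0 => /(_ erefl).
have K' y : 0 <= y <= r -> w * (w * f2 (c + w * y)) <= K.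
  move=> /andP[y0 yr]; rewrite mulrA -expr2 w2 mul1r f2K//.
  by rewrite addrC addKr absw ger0_norm.
move=> /(_ K' (w * (x - c))); rewrite wE exprMn w2 mul1r.
have -> : c + (x - c) = x by ring.
apply.
by rewrite wx/= -(ger0_norm wx) absw.
Qed.

Lemma has_derive1_sum (R : realType) (J : Type) (r : seq J) (P : pred J)
    (f df : J -> R -> R) :
  (forall i, has_derive1 (f i) (df i)) ->
  has_derive1 (fun x => \sum_(i <- r | P i) f i x) (fun x => \sum_(i <- r | P i) df i x).
Proof.
move=> fdf x; have -> : (fun x => \sum_(i <- r | P i) f i x) = \sum_(i <- r | P i) f i.
  by apply/funext => y; rewrite fct_sumE.
by elim/big_ind2 : _ => [|u du v dv hu hv|i _]; [exact: is_derive_cst|exact: is_deriveD|exact: fdf].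
Qed.

Lemma has_derive1D (R : realType) (f g df dg : R -> R) :
  has_derive1 f df -> has_derive1 g dg ->
  has_derive1 (fun x => f x + g x) (fun x => df x + dg x).
Proof. by move=> fdf gdg x; exact: (is_deriveD (fdf x) (gdg x)). Qed.

Lemma has_derive1Z (R : realType) (k : R) (f df : R -> R) :
  has_derive1 f df -> has_derive1 (fun x => k * f x) (fun x => k * df x).
Proof. by move=> fdf x; exact: (is_deriveZ k (fdf x)). Qed.

Lemma has_derive1_shift (R : realType) (k : R) (f df : R -> R) :
  has_derive1 f df -> has_derive1 (fun x => f (x + k)) (fun x => df (x + k)).
Proof.
move=> fdf x; rewrite -[df _]mulr1.
apply: (@is_derive1_comp _ f (fun x => x + k)); first exact: fdf.
exact: is_derive_shift.
Qed.

(** Everything the certificate asks of the even pulse [G] and the odd pulse [H]. Size conditions on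
    [G] are imposed on the grid of mesh [h] only. [D] and [E] must be the derivatives of [G] and [H]
    only when [h <= eps]; on a coarser grid they merely complete the linear system. *)
Record profile (R : realType) (eps beta h C d : R) (G H D E : R -> R) : Prop :=
  Profile {
    profileG : decay C G;
    profileH : decay C H;
    profileD : decay C D;
    profileE : decay C E;
    profileH0 : H 0 = 0;
    profileD0 : D 0 = 0;
    profileG0 : d <= G 0;
    profileE0 : d <= E 0;
    profile_peak : beta * eps ^+ 2 / 2 <= G 0;
    profile_low : forall k : int, - G 0 + beta * eps ^+ 2 / 4 <= G (k%:~R * h);
    profile_far : forall k : int, eps < `|k%:~R * h| ->
      G (k%:~R * h) <= G 0 - beta * eps ^+ 2 / 2;
    profile_near : forall k : int, `|k%:~R * h| <= eps ->
      G (k%:~R * h) <= G 0 - beta * (k%:~R * h) ^+ 2 / 2;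
    profile_smooth : h <= eps -> exists D2 E2 : R -> R,
      [/\ has_derive1 G D, has_derive1 D D2, has_derive1 H E,
          has_derive1 E E2 & decay C D2 /\ decay C E2] }.

(** Near a node [t m], [s m * W u] follows [G (u - t m)] up to [beta * eps ^+ 2 / 12], which settles
    the lower bound and the points beyond [eps]. Within [eps] a second-order comparison is needed:
    the vanishing slope at [t m] lets the concavity of the main pulse dominate the remainder. *)
Lemma certificate (R : realType) (eps beta h C d nu rho : R)
    (G H D E : R -> R) (J : finType) (t s : J -> R) :
  profile eps beta h C d G H D E ->
  0 < eps -> 0 < beta -> 0 < h -> 0 <= C -> 0 < d -> 0 < nu ->
  let e := C * (16 / nu ^+ 2) in
  let kappa := 4 * C / d ^+ 2 * e in
  2 * eps <= nu -> 4 * e <= d -> kappa <= 1 / 12 ->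
  2 * kappa * C + 2 * e <= beta * eps ^+ 2 / 12 ->
  kappa * C + 2 * e <= beta / 3 ->
  rho <= beta * eps ^+ 2 / 6 -> (h <= eps -> rho <= beta * h ^+ 2 / 6) ->
  (forall i j, i != j -> nu <= `|t i - t j|) ->
  (forall i, `|s i| = 1) ->
  exists a b : J -> R,
    let W u := \sum_l a l * G (u - t l) + \sum_l b l * H (u - t l) in
    [/\ forall m, `|a m| <= 1 + 1 / 12, forall m, `|b m| <= 1 / 12,
        forall m, W (t m) = s m * G 0 &
        forall u, (forall m, exists2 k : int, k != 0 & u - t m = k%:~R * h) ->
          `|W u| <= G 0 - rho].
Proof.
move=> [GC HC DC EC H0 D0 Gd Ed peak low far near smooth] e0' b0 h0 C0 d0 nu0.
move=> e kappa nueps ed kappa1 small1 small2 rho1 rho2 sep s1.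
have s1' i : `|s i| <= 1 by rewrite s1.
have [a [b [aGb aDb as_ bs]]] := interpolation nu0 C0 d0 sep GC HC DC EC H0 D0 Gd Ed ed s1'.
rewrite -/e -/kappa in as_ bs.
have e0 : 0 <= e by rewrite mulr_ge0// divr_ge0// sqr_ge0.
have kappa0 : 0 <= kappa by rewrite mulr_ge0// divr_ge0// ?sqr_ge0// mulr_ge0.
have a1 m : `|a m| <= 1 + kappa.
  by rewrite -[a m](subrK (s m)) addrC; apply: le_trans (ler_normD _ _) _; rewrite s1 lerD2l.
have k10 : 0 <= 1 + kappa by lra.
have sepsum (f : R -> R) (P : pred J) u : decay C f -> (forall i, P i -> nu / 2 <= `|u - t i|) ->
    `|\sum_(l | P l) a l * f (u - t l)| <= (1 + kappa) * e /\
    `|\sum_(l | P l) b l * f (u - t l)| <= kappa * e.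
  by move=> fC far'; split; apply: (separated_combination_le nu0 C0 sep far' fC).
exists a, b => W; split.
- by move=> m; apply: le_trans (a1 m) _; lra.
- by move=> m; apply: le_trans (bs m) _.
- exact: aGb.
move=> u ulat.
(* If no node is within [nu / 2], [W u] consists of tails only. *)
have [[m um]|nom] := pselect (exists m, `|u - t m| < nu / 2); last first.
  have farl l : xpredT l -> nu / 2 <= `|u - t l|.
    by move=> _; rewrite leNgt; apply/negP => ul; apply: nom; exists l.
  have [h1 _] := sepsum G xpredT u GC farl.
  have [_ h2] := sepsum H xpredT u HC farl.
  apply: le_trans (ler_normD _ _) _.
  have : kappa * e <= 1 / 12 * e by rewrite ler_wpM2r.
  move: h1; rewrite mulrDl mul1r; lra.
have farl v l : `|v - t m| <= nu / 2 -> l != m -> nu / 2 <= `|v - t l|.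
  move=> vm /sep lm; have := ler_distD v (t l) (t m).
  rewrite (distrC (t l) v); lra.
(* All but the main pulse at [t m]. The odd pulse at [t m] belongs here too, its coefficient being
   at most [kappa]. *)
pose F v := \sum_(l | l != m) a l * G (v - t l) + (\sum_(l | l != m) b l * H (v - t l) + b m * H (v - t m)).
have WF v : W v = a m * G (v - t m) + F v.
  by rewrite /W/F (bigD1 m)//= [X in _ + X](bigD1 m)//=; ring.
have [k k0 uk] := ulat m.
have sab x : s m * x <= `|x| by apply: le_trans (ler_norm _) _; rewrite normrM s1 mul1r.
have sW : `|W u| = `|s m * W u| by rewrite normrM s1 mul1r.
have sa : `|s m * a m - 1| <= kappa.
  have s2 : s m * s m = 1 by rewrite -expr2 -real_normK ?num_real// s1 expr1n.
  by rewrite -s2 -mulrBr normrM s1 mul1r.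
have kC : kappa * e <= 1 / 12 * e by rewrite ler_wpM2r.
have GuC : `|G (u - t m)| <= C by exact: decay_bound.
have close : `|s m * W u - G (u - t m)| <= beta * eps ^+ 2 / 12.
  apply: le_trans small1.
  rewrite WF; have -> : s m * (a m * G (u - t m) + F u) - G (u - t m) =
    (s m * a m - 1) * G (u - t m) + s m * F u by ring.
  apply: le_trans (ler_normD _ _) _.
  have : `|(s m * a m - 1) * G (u - t m)| <= kappa * C by rewrite normrM ler_pM.
  have : `|s m * F u| <= (1 + kappa) * e + (kappa * e + kappa * C).
    rewrite normrM s1 mul1r; apply: le_trans (ler_normD _ _) _; apply: lerD.
      by have [] := sepsum G _ u GC (fun l => farl u l (ltW um)).
    apply: le_trans (ler_normD _ _) _; apply: lerD.
      by have [] := sepsum H _ u HC (fun l => farl u l (ltW um)).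
    by rewrite normrM ler_pM// decay_bound.
  rewrite mulrDl mul1r; lra.
have lowu : - G 0 + beta * eps ^+ 2 / 4 <= G (u - t m) by rewrite uk.
rewrite sW ler_norml; move: close; rewrite ler_distl => /andP[close1 close2].
apply/andP; split; first by lra.
have [uf|un] := ltP eps `|u - t m|.
  have : G (u - t m) <= G 0 - beta * eps ^+ 2 / 2 by rewrite uk far// -uk.
  by lra.
(* A nonzero multiple of [h] has modulus at least [h]; so being within [eps] of a node forces
   [h <= eps], and [profile_smooth] applies. *)
have kh : h ^+ 2 <= (u - t m) ^+ 2.
  rewrite uk exprMn ler_peMl ?sqr_ge0// -rmorphXn/= ler1z.
  by rewrite -gtz0_ge1 exprn_even_gt0.
have heps : h <= eps.
  apply: le_trans un; by rewrite -ler_sqr ?nnegrE ?normr_ge0 ?(ltW h0)// real_normK ?num_real.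
have nearu : G (u - t m) <= G 0 - beta * (u - t m) ^+ 2 / 2 by rewrite uk near// -uk.
have [D2 [E2 [dG dD dH dE [D2C E2C]]]] := smooth heps.
pose combo (f g : R -> R) v := \sum_(l | l != m) a l * f (v - t l) +
  (\sum_(l | l != m) b l * g (v - t l) + b m * g (v - t m)).
have dcombo (f g f1 g1 : R -> R) : has_derive1 f f1 -> has_derive1 g g1 ->
    has_derive1 (combo f g) (combo f1 g1).
  move=> df dg; apply: has_derive1D; last apply: has_derive1D.
  - by apply: has_derive1_sum => l; apply/has_derive1Z/has_derive1_shift.
  - by apply: has_derive1_sum => l; apply/has_derive1Z/has_derive1_shift.
  - exact/has_derive1Z/has_derive1_shift.
(* The main pulse contributes [a m * D 0 = 0] to the slope condition, which therefore concerns [F]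
   alone. *)
have F1 : combo D E (t m) = 0.
  have := aDb m; rewrite (bigD1 m)//= [X in _ + X = _](bigD1 m)//= subrr D0 => <-.
  by rewrite /combo subrr; ring.
have F2 v : `|v - t m| <= eps -> `|combo D2 E2 v| <= beta / 3.
  move=> vm; have vnu : `|v - t m| <= nu / 2 by lra.
  apply: le_trans small2.
  apply: (@le_trans _ _ ((1 + kappa) * e + (kappa * e + kappa * C))); last by rewrite mulrDl mul1r; lra.
  apply: le_trans (ler_normD _ _) _; apply: lerD.
    by have [] := sepsum D2 _ v D2C (fun l => farl v l vnu).
  apply: le_trans (ler_normD _ _) _; apply: lerD.
    by have [] := sepsum E2 _ v E2C (fun l => farl v l vnu).
  by rewrite normrM ler_pM// decay_bound.
have FW : s m * F u <= s m * F (t m) + beta / 3 / 2 * (u - t m) ^+ 2.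
  apply: (@taylor2_le _ (fun v => s m * F v) (fun v => s m * combo D E v)
    (fun v => s m * combo D2 E2 v) _ _ eps) => //.
  - exact/has_derive1Z/dcombo.
  - exact/has_derive1Z/dcombo.
  - by rewrite F1 mulr0.
  - by move=> v /F2 vF; apply: le_trans (sab _) vF.
have Wm : s m * W (t m) = G 0.
  by rewrite [W _]aGb mulrA -expr2 -real_normK ?num_real// s1 expr1n mul1r.
have : s m * W u - s m * W (t m) = s m * a m * (G (u - t m) - G 0) + (s m * F u - s m * F (t m)).
  by rewrite !WF subrr; ring.
rewrite Wm.
have : s m * a m * (G (u - t m) - G 0) <= 11 / 12 * (G (u - t m) - G 0).
  rewrite ler_wnM2r//; first by have := mulr_ge0 (ltW b0) (sqr_ge0 (u - t m)); lra.
  by move: sa; rewrite ler_distl => /andP[+ _]; lra.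
(* The main pulse loses [11 / 24] of [beta * (u - t m) ^+ 2] and [F] regains at most [4 / 24]; the
   remaining [7 / 24] exceeds the required [1 / 6]. *)
have : beta * h ^+ 2 <= beta * (u - t m) ^+ 2 by rewrite ler_wpM2l// (ltW b0).
move: (rho2 heps) (mulr_ge0 (ltW b0) (sqr_ge0 (u - t m))) FW nearu.
clear; lra.
Qed.

(** * Pulses built from an admissible kernel *)

Lemma decay_le (R : realType) (C C' : R) (f : R -> R) :
  C <= C' -> decay C f -> decay C' f.
Proof.
move=> CC' fC t; apply: le_trans (fC t) _.
by rewrite ler_wpM2r// invr_ge0 addr_ge0// sqr_ge0.
Qed.

Lemma decayD (R : realType) (C C' : R) (f g : R -> R) :
  decay C f -> decay C' g -> decay (C + C') (fun x => f x + g x).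
Proof. by move=> fC gC t; rewrite mulrDl (le_trans (ler_normD _ _))// lerD. Qed.

Lemma decayZ (R : realType) (C k : R) (f : R -> R) :
  decay C f -> decay (`|k| * C) (fun x => k * f x).
Proof. by move=> fC t; rewrite normrM -mulrA ler_wpM2l. Qed.

Lemma decay_shift (R : realType) (C k : R) (f : R -> R) :
  0 <= C -> decay C f -> decay (2 * (1 + k ^+ 2) * C) (fun x => f (x + k)).
Proof.
move=> C0 fC x; apply: le_trans (fC (x + k)) _.
have p1 y : 0 < 1 + y ^+ 2 :> R by rewrite ltr_pwDl// sqr_ge0.
rewrite ler_pdivrMr// mulrAC ler_pdivlMr// [_ * C]mulrC -mulrA ler_wpM2l//.
(* [2 * (1 + k ^+ 2) * (1 + (x + k) ^+ 2) - (1 + x ^+ 2)] equals [1 + (x + 2 * k) ^+ 2 + 2 * k ^+ 2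
   * (x + k) ^+ 2]. *)
have := mulr_ge0 (sqr_ge0 k) (sqr_ge0 (x + k)).
by have := sqr_ge0 (x + 2 * k); lra.
Qed.

(* [b] switches the side pulses on: they are used only when [f] goes below
   [- f 0 / 2] on the grid, which keeps [tau] bounded. *)
Definition even_comb (R : realType) (b : bool) (tau : R) (f : R -> R) (x : R) : R :=
  f x - b%:R / 2 * (f (x + tau) + f (x - tau)).

(** For even differentiable [f] and [b] true, an odd pulse with slope [- 2 f'(tau)] at [0]. With [b]
    false it is the zero pulse, used on coarse grids. *)
Definition odd_comb (R : realType) (b : bool) (tau : R) (f : R -> R) (x : R) : R :=
  b%:R * (f (x - tau) - f (x + tau)).

Lemma decay_even_comb (R : realType) (b : bool) (tau C Q : R) (f : R -> R) :
  0 <= C -> 1 + tau ^+ 2 <= Q -> decay C f -> decay (4 * Q * C) (even_comb b tau f).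
Proof.
move=> C0 tauQ fC.
have Q1 : 1 <= Q by apply: le_trans tauQ; rewrite lerDl sqr_ge0.
have h : decay (`|- (b%:R / 2)| * (2 * (1 + tau ^+ 2) * C + 2 * (1 + (- tau) ^+ 2) * C))
    (fun x => - (b%:R / 2) * (f (x + tau) + f (x - tau))).
  by apply: decayZ; apply: decayD; exact: decay_shift.
move=> t; have := decayD fC h t; rewrite /even_comb mulNr => /le_trans; apply.
rewrite ler_wpM2r ?invr_ge0 ?addr_ge0 ?sqr_ge0// sqrrN normrN ger0_norm ?divr_ge0//.
have : b%:R / 2 <= 1 / 2 :> R by case: b {h} => /=; lra.
have := ler_wpM2r C0 tauQ; have := ler_wpM2r C0 Q1.
move: (b%:R / 2) => z h1 h2 z2.
have := ler_wpM2r (_ : 0 <= (1 + tau ^+ 2) * C) z2.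
by rewrite mulr_ge0 ?addr_ge0 ?sqr_ge0// => /(_ isT); lra.
Qed.

Lemma decay_odd_comb (R : realType) (b : bool) (tau C Q : R) (f : R -> R) :
  0 <= C -> 1 + tau ^+ 2 <= Q -> decay C f -> decay (4 * Q * C) (odd_comb b tau f).
Proof.
move=> C0 tauQ fC.
have h : decay (`|b%:R| * (2 * (1 + (- tau) ^+ 2) * C + `|-1| * (2 * (1 + tau ^+ 2) * C)))
    (fun x => b%:R * (f (x - tau) + (-1) * f (x + tau))).
  by apply: decayZ; apply: decayD; [|apply: decayZ]; exact: decay_shift.
move=> t; have := h t; rewrite /odd_comb mulN1r => /le_trans; apply.
rewrite ler_wpM2r ?invr_ge0 ?addr_ge0 ?sqr_ge0// sqrrN normrN normr1 mul1r.
have Q1 : 1 <= Q by apply: le_trans tauQ; rewrite lerDl sqr_ge0.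
have := ler_wpM2r C0 tauQ; have := ler_wpM2r C0 Q1.
by case: b {h} => /=; rewrite ?normr1 ?normr0; lra.
Qed.

Lemma has_derive1_even_comb (R : realType) (b : bool) (tau : R) (f f1 : R -> R) :
  has_derive1 f f1 -> has_derive1 (even_comb b tau f) (even_comb b tau f1).
Proof.
move=> df.
have combE F : even_comb b tau F = (fun x => F x + - (b%:R / 2) * (F (x + tau) + F (x - tau))).
  by apply/funext => y; rewrite mulNr.
rewrite !combE; apply: (has_derive1D df); apply: has_derive1Z.
by apply: has_derive1D; exact: has_derive1_shift.
Qed.

Lemma has_derive1_odd_comb (R : realType) (b : bool) (tau : R) (f f1 : R -> R) :
  has_derive1 f f1 -> has_derive1 (odd_comb b tau f) (odd_comb b tau f1).
Proof.
move=> df.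
have combE F : odd_comb b tau F = (fun x => b%:R * (F (x - tau) + -1 * F (x + tau))).
  by apply/funext => y; rewrite mulN1r.
rewrite !combE; apply: has_derive1Z; apply: has_derive1D; last apply: has_derive1Z.
all: exact: has_derive1_shift.
Qed.

Lemma has_derive1_unique (R : realType) (f f1 f2 : R -> R) :
  has_derive1 f f1 -> has_derive1 f f2 -> f1 = f2.
Proof.
by move=> d1 d2; apply/funext => x; case: (d1 x) => _ <-; case: (d2 x) => _ <-.
Qed.

Lemma even_derive1_odd (R : realType) (f f1 : R -> R) :
  (forall x, f (- x) = f x) -> has_derive1 f f1 -> forall x, f1 (- x) = - f1 x.
Proof.
move=> fN df x.
have dN : has_derive1 f (fun y => f1 (- y) * -1).
  move=> y; have -> : f = f \o -%R by apply/funext => z /=; rewrite fN.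
  exact: is_derive1_comp.
have fE : f1 x = f1 (- x) * -1 by rewrite -[LHS]/(f1 x) {1}(has_derive1_unique df dN).
by rewrite fE mulrN1 opprK.
Qed.

Lemma admissible_derive (R : realType) (g : R -> R) (eps beta : R) :
  admissible g eps beta -> exists g1 g2 : R -> R, exists2 C : R, 0 < C &
  [/\ has_derive1 g g1, has_derive1 g1 g2, decay C g, decay C g1 & decay C g2 /\
    forall t, `|t| <= eps -> g2 t < - beta].
Proof.
move=> [_ _ [der _] _ dec _ _ conc].
have hd l : (l < 3)%N -> has_derive1 (g^`(l)%classic) (g^`(l.+1)%classic).
  by move=> l3 x; rewrite derive1nS derive1E; apply/derivableP; exact: der.
have [C0 C00 h0] := dec 0%N isT; have [C1 C10 h1] := dec 1%N isT.
have [C2 C20 h2] := dec 2%N isT.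
have [le0 le1 le2] : [/\ C0 <= C0 + C1 + C2, C1 <= C0 + C1 + C2 & C2 <= C0 + C1 + C2].
  by split; lra.
exists (g^`(1)%classic), (g^`(2)%classic), (C0 + C1 + C2); first lra.
split.
- exact: hd 0%N isT.
- exact: hd 1%N isT.
- exact: decay_le le0 h0.
- exact: decay_le le1 h1.
- by split; [exact: decay_le le2 h2|exact: conc].
Qed.

(** By decay, values below [- m] occur only where [1 + t ^+ 2 <= C / m], hence at finitely many grid
    points, and evenness allows a nonnegative minimizer. *)
Lemma grid_argmin (R : realType) (g : R -> R) (h C m : R) :
  0 < h -> 0 < m -> (forall t, g (- t) = g t) -> decay C g ->
  (exists k : int, g (k%:~R * h) < - m) ->
  exists r : nat, [/\ g (r%:R * h) < - m, 1 + (r%:R * h) ^+ 2 <= C / m &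
    forall k : int, g (r%:R * h) <= g (k%:~R * h)].
Proof.
move=> h0 m0 gN gC [k0 gk0].
have absE k : g (k%:~R * h) = g (`|k|%N%:R * h).
  case: (intP k) => [|n|n] //; rewrite ?abszN1//.
  by rewrite rmorphN/= mulNr gN.
have bd n : g (n%:R * h) < - m -> 1 + (n%:R * h) ^+ 2 <= C / m.
  move=> gn; rewrite ler_pdivlMr// mulrC -ler_pdivlMr ?ltr_pwDl ?sqr_ge0//.
  by apply: le_trans (gC _); rewrite -normrN; apply: le_trans (ler_norm _); lra.
pose N := Num.truncn (C / m / h).
have inN n : g (n%:R * h) < - m -> (n < N.+1)%N.
  move=> /bd nb; rewrite ltnS truncn_ge_nat; last first.
    rewrite divr_ge0 ?(ltW h0)//; apply: le_trans nb.
    by rewrite addr_ge0// sqr_ge0.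
  rewrite ler_pdivlMr//; apply: le_trans nb.
  by have := sqr_ge0 (n%:R * h - 1); have := sqr_ge0 (n%:R * h); lra.
rewrite absE in gk0.
have [r rmin] : exists r : 'I_N.+1, forall i : 'I_N.+1, g (r%:R * h) <= g (i%:R * h).
  have [r _ rmin] := Order.TotalTheory.arg_minP (fun i : 'I_N.+1 => g (i%:R * h))
    (erefl : xpredT (ord0 : 'I_N.+1)).
  by exists r => i; exact: rmin.
have gr : g (r%:R * h) < - m.
  by apply: (le_lt_trans _ gk0); exact: (rmin (Ordinal (inN _ gk0))).
exists r; split; [by []|exact: bd|move=> k; rewrite absE].
have [/inN kN|km] := ltP (g (`|k|%N%:R * h)) (- m); first exact: (rmin (Ordinal kN)).
exact: le_trans (ltW gr) km.
Qed.

(** The constants [C], [d], [Q] are chosen before the mesh [h]; this uniformity makes the separation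
    constant independent of [sigma] and [N]. *)
Lemma kernel_profile (R : realType) (g : R -> R) (eps beta : R) :
  admissible g eps beta -> exists C d Q : R, [/\ 0 < C, 0 < d &
    forall h : R, 0 < h ->
    exists (b b' : bool) (r r' : nat) (D E : R -> R),
      [/\ profile eps beta h C d (even_comb b (r%:R * h) g)
             (odd_comb b' (r'%:R * h) g) D E,
          b -> (0 < r)%N & b -> r%:R * h < Q]].
Proof.
move=> hg; have [e0 b0 _ gN _ gpos gfar _] := hg.
have [g1 [g2 [C C0 [dg dg1 gC g1C [g2C conc]]]]] := admissible_derive hg.
have g1N := even_derive1_odd gN dg.
have g10 : g1 0 = 0 by have := g1N 0; rewrite oppr0; lra.
have near x : `|x| <= eps -> g x <= g 0 - beta * x ^+ 2 / 2.
  move=> xe; have := @taylor2_le _ g g1 g2 0 (- beta) eps dg dg1 g10.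
  move=> /(_ _ x); rewrite subr0 => H; apply: le_trans (H _ xe) _; last by lra.
  by move=> y; rewrite subr0 => /conc /ltW.
have neareps : g eps <= g 0 - beta * eps ^+ 2 / 2 by rewrite near// gtr0_norm.
have be0 : 0 < beta * eps ^+ 2 by rewrite mulr_gt0// exprn_gt0.
have geps : 0 < g eps by rewrite gpos// gtr0_norm.
have far x : eps < `|x| -> g x <= g 0 - beta * eps ^+ 2 / 2.
  by move=> /gfar gx; lra.
have g0max x : g x <= g 0.
  have [xe|xe] := ltP eps `|x|; first by have := far x xe; lra.
  by have := near x xe; have := mulr_ge0 (ltW b0) (sqr_ge0 x); lra.
have g00 : 0 < g 0 by lra.
(* If [g] stays above [- g 0 / 2] on the grid, [g] itself serves as [G]; otherwise the minimizer
   [tau] satisfies [1 + tau ^+ 2 <= C / m]. *)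
pose m := g 0 / 2; have m0 : 0 < m by rewrite divr_gt0.
pose Q := 1 + C / m + eps ^+ 2; have Cm : 0 <= C / m by rewrite divr_ge0 ?ltW.
have Q1 : 1 <= Q by rewrite /Q; have := sqr_ge0 eps; lra.
pose d := Num.min (g 0) (beta * eps).
have d0 : 0 < d by rewrite lt_min g00 mulr_gt0.
have [dg0 dbe] : d <= g 0 /\ d <= beta * eps by rewrite /d !ge_min !lexx orbT.
have K0 : 0 <= 4 * Q * C by rewrite !mulr_ge0// ltW// (lt_le_trans ltr01).
(* The extra [d] covers the function [d / (1 + x ^+ 2)] that stands for [E] on coarse grids. *)
exists (4 * Q * C + d), d, Q; split=> // [|h h0]; first by rewrite ltr_wpDl.
have [b [r [r0 rQ rlow ltau rQ']]] : exists (b : bool) (r : nat), [/\ b -> (0 < r)%N,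
    1 + (r%:R * h) ^+ 2 <= Q,
    forall k : int, (if b then g (r%:R * h) else - m) <= g (k%:~R * h),
    b -> eps < r%:R * h /\ g (r%:R * h) <= 0 & b -> r%:R * h < Q].
  have [rex|norex] := pselect (exists k : int, g (k%:~R * h) < - m).
    have [r [grm rQ rmin]] := grid_argmin h0 m0 gN gC rex.
    have rQ1 : 1 + (r%:R * h) ^+ 2 <= Q by rewrite /Q; have := sqr_ge0 eps; lra.
    have rh0 : 0 <= r%:R * h by rewrite mulr_ge0// ltW.
    exists true, r; split=> // _.
    - by case: r grm {rQ rmin rQ1 rh0} => //; rewrite mul0r; lra.
    - split; last by lra.
      rewrite ltNge; apply/negP => re; have := gpos (r%:R * h).
      by rewrite ger0_norm// => /(_ re); lra.
    - by apply: lt_le_trans rQ1; have := sqr_ge0 (r%:R * h - 1 / 2); lra.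
  exists false, 0%N; split=> //; first by rewrite mul0r expr0n/= addr0.
  by move=> k; rewrite leNgt; apply/negP => gk; apply: norex; exists k.
set tau := r%:R * h in rQ rlow ltau rQ' *.
have gridD k : k%:~R * h + tau = (k + r%:Z)%:~R * h by rewrite /tau rmorphD/= mulrDl.
have gridB k : k%:~R * h - tau = (k - r%:Z)%:~R * h by rewrite /tau rmorphB/= mulrBl.
pose G := even_comb b tau g.
have G0 : G 0 = g 0 - b%:R * g tau.
  by rewrite /G /even_comb add0r sub0r gN; field.
(* When the side pulses are on, the shifted values are at least [g tau] and equal it at [k = 0]:
   subtracting their mean can only deepen the drop from the peak. *)
have drop k : G (k%:~R * h) - G 0 <= g (k%:~R * h) - g 0.
  rewrite G0 /G /even_comb gridD gridB.
  have := rlow (k + r%:Z); have := rlow (k - r%:Z); case: (b) => /=; lra.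
have G0g : g 0 <= G 0.
  by rewrite G0; move: ltau; case: (b) => /= [/(_ isT)[_]|_]; lra.
have glow k : - G 0 + beta * eps ^+ 2 / 4 <= G (k%:~R * h).
  rewrite G0 /G /even_comb; have := rlow k; move: ltau.
  case: (b) => /= [/(_ isT)[te _]|_] low; last by rewrite /m in low; lra.
  (* As [tau > eps], the two shifted points are more than [2 * eps] apart, so one of them lies
     beyond [eps]; the mean of the two values is then at most [g 0 - beta * eps ^+ 2 / 4]. *)
  have [xe|xe] := ltP eps `|k%:~R * h + tau|.
    by have := far _ xe; have := g0max (k%:~R * h - tau); lra.
  have : eps < `|k%:~R * h - tau|.
    rewrite distrC; apply: lt_le_trans (ler_norm _).
    by move: xe; rewrite ler_norml => /andP[_]; lra.
  by move=> /far; have := g0max (k%:~R * h + tau); lra.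
have epsQ (x : R) : `|x| <= eps -> 1 + x ^+ 2 <= Q.
  move=> xe; have : x ^+ 2 <= eps ^+ 2.
    by rewrite -[x ^+ 2]real_normK ?num_real// ler_sqr ?nnegrE ?normr_ge0 ?(ltW e0).
  by rewrite /Q; lra.
have GD : decay (4 * Q * C + d) (even_comb b tau g1).
  by apply: decay_le (decay_even_comb _ (ltW C0) rQ g1C); lra.
have D0 : even_comb b tau g1 0 = 0.
  by rewrite /even_comb add0r sub0r g1N g10; ring.
have GG : decay (4 * Q * C + d) G.
  by apply: decay_le (decay_even_comb _ (ltW C0) rQ gC); lra.
have Gfar k : eps < `|k%:~R * h| -> G (k%:~R * h) <= G 0 - beta * eps ^+ 2 / 2.
  by move=> /far; have := drop k; lra.
have Gnear k : `|k%:~R * h| <= eps -> G (k%:~R * h) <= G 0 - beta * (k%:~R * h) ^+ 2 / 2.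
  by move=> /near; have := drop k; lra.
have [hle|hgt] := leP h eps; last first.
  exists b, false, r, 0%N, (even_comb b tau g1), (fun x => d / (1 + x ^+ 2)).
  split; [|exact: r0|exact: rQ']; split=> //.
  - by move=> x; rewrite /odd_comb mul0r normr0 divr_ge0 ?addr_ge0 ?sqr_ge0//; lra.
  - move=> x; have p : 0 <= (1 + x ^+ 2)^-1 by rewrite invr_ge0 addr_ge0// sqr_ge0.
    by rewrite ger0_norm ?mulr_ge0 ?(ltW d0)// ler_wpM2r//; lra.
  - by rewrite /odd_comb mul0r.
  - exact: le_trans dg0 G0g.
  - by rewrite expr0n/= addr0 divr1.
  - by apply: le_trans G0g; lra.
  - by move=> hle; move: (le_lt_trans hle hgt); rewrite ltxx.
(* [t'] is the largest grid point up to [eps]; since [h <= eps], it is at least [eps / 2], and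
   concavity gives [E 0 = - 2 * g1 t' >= beta * eps]. *)
pose n := Num.truncn (eps / h); pose t' := n%:R * h.
have /andP[n1 n2] := truncn_itv (divr_ge0 (ltW e0) (ltW h0)).
rewrite -/n ler_pdivlMr// ltr_pdivrMr// -natr1 mulrDl mul1r -/t' in n1 n2.
have n0 : 1 <= n%:R :> R.
  by rewrite ler1n /n truncn_gt0 ler_pdivlMr// mul1r.
have ht' : h <= t' by rewrite ler_peMl// ltW.
have tQ : 1 + t' ^+ 2 <= Q by rewrite epsQ// ger0_norm//; lra.
exists b, true, r, n, (even_comb b tau g1), (odd_comb true t' g1).
split; [|exact: r0|exact: rQ']; split=> //.
- by apply: decay_le (decay_odd_comb _ (ltW C0) tQ gC); lra.
- by apply: decay_le (decay_odd_comb _ (ltW C0) tQ g1C); lra.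
- by rewrite /odd_comb !add0r gN subrr mulr0.
- exact: le_trans dg0 G0g.
- rewrite /odd_comb !add0r g1N mul1r.
  have := @has_derive1_le_right _ g1 g2 (- beta) eps dg1 _ t'; rewrite g10 => H.
  have : g1 t' <= 0 + - beta * t'.
    apply: H; last by rewrite n1; lra.
    by move=> x /andP[x0 xe]; rewrite ltW// conc// ger0_norm.
  have : beta * eps <= beta * (2 * t') by rewrite ler_wpM2l ?ltW//; lra.
  lra.
- by apply: le_trans G0g; lra.
- exists (even_comb b tau g2), (odd_comb true t' g2); split.
  + exact: has_derive1_even_comb.
  + exact: has_derive1_even_comb.
  + exact: has_derive1_odd_comb.
  + exact: has_derive1_odd_comb.
  + by split; [apply: decay_le (decay_even_comb _ (ltW C0) rQ g2C)|
       apply: decay_le (decay_odd_comb _ (ltW C0) tQ g2C)]; lra.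
Qed.

(** * Sums of summable families *)

Definition rsummable (R : realType) (T : choiceType) (f : T -> R) : Prop :=
  summable [set: T] (EFin \o f).

Section rsum.
Context {R : realType} {T : choiceType}.
Implicit Types f g : T -> R.

Lemma ler_sum_fset (X Y : {fset T}) f :
  (X `<=` Y)%fset -> (forall i, 0 <= f i) ->
  \sum_(i <- X) f i <= \sum_(i <- Y) f i.
Proof.
move=> XY f0; pose f' i := if i \in X then f i else 0.
have -> : \sum_(i <- X) f i = \sum_(i <- X) f' i.
  by rewrite !big_seq; apply: eq_bigr => i iX; rewrite /f' iX.
rewrite (big_fset_incl _ XY)/=; last by move=> i _ /negbTE iX; rewrite /f' iX.
by apply: ler_sum => i _; rewrite /f'; case: ifP.
Qed.

Lemma esum_fset_le f (X : {fset T}) :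
  ((\sum_(i <- X) f i)%:E <= \esum_(i in [set: T]) (f i)%:E)%E.
Proof.
apply: ereal_sup_ubound; exists [set` X]; first by split=> //; exact: finite_fset.
by rewrite fsbig_finite ?finite_fset//= set_fsetK sumEFin.
Qed.

Lemma esum_fset_approx f (e : R) :
  (forall i, 0 <= f i) -> (\esum_(i in [set: T]) (f i)%:E < +oo)%E -> 0 < e ->
  exists X : {fset T}, forall Y : {fset T}, (X `<=` Y)%fset ->
    `|\sum_(i <- Y) f i - fine (\esum_(i in [set: T]) (f i)%:E)| <= e.
Proof.
move=> f0 foo e0; set s := esum _ _.
have sfin : s \is a fin_num.
  by rewrite ge0_fin_numE//; apply: esum_ge0 => i _; rewrite lee_fin.
have [_ [Z [finZ _] <-]] := ub_ereal_sup_adherent e0 sfin.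
rewrite fsbig_finite//= sumEFin => sZ.
have {}sZ : (s - e%:E < (\sum_(i <- fset_set Z) f i)%:E)%E := sZ.
exists (fset_set Z) => Y ZY.
have := esum_fset_le f Y; rewrite -/s; have := ler_sum_fset ZY f0.
move: sZ; rewrite -(fineK sfin) -EFinB lte_fin lee_fin => h1 h2 h3.
by rewrite ler_distl; apply/andP; split; lra.
Qed.

(** [rsum] is the limit of finite sums along inclusion. Together with uniqueness of that limit, this
    gives linearity and monotonicity without returning to positive and negative parts. *)
Lemma rsum_approx f (e : R) : rsummable f -> 0 < e ->
  exists X : {fset T}, forall Y : {fset T}, (X `<=` Y)%fset ->
    `|\sum_(i <- Y) f i - rsum f| <= e.
Proof.
move=> sf e0; have e20 : 0 < e / 2 by rewrite divr_gt0.
have maxoo (h : T -> R) : (forall i, Num.max (h i) 0 <= `|f i|) ->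
    (\esum_(i in [set: T]) (Num.max (h i) 0)%:E < +oo)%E.
  by move=> hf; apply: le_lt_trans sf; apply: le_esum => i _; rewrite /= lee_fin.
have [||X1 HX1] := @esum_fset_approx (fun i => Num.max (f i) 0) _ _ _ e20.
- by move=> i; rewrite le_max lexx orbT.
- by apply: maxoo => i; rewrite ge_max ler_norm normr_ge0.
have [||X2 HX2] := @esum_fset_approx (fun i => Num.max (- f i) 0) _ _ _ e20.
- by move=> i; rewrite le_max lexx orbT.
- by apply: maxoo => i; rewrite ge_max normr_ge0 -normrN ler_norm.
exists (X1 `|` X2)%fset => Y; rewrite fsubUset => /andP[/HX1 h1 /HX2 h2].
have -> : \sum_(i <- Y) f i =
    \sum_(i <- Y) Num.max (f i) 0 - \sum_(i <- Y) Num.max (- f i) 0.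
  rewrite -sumrB; apply: eq_bigr => i _; rewrite !maxEle oppr_le0.
  by case: (lerP (f i) 0) => fi; case: (lerP 0 (f i)) => fi'; lra.
rewrite /rsum; set a := \sum_(i <- Y) _; set b := \sum_(i <- Y) _.
set u := fine _; set v := fine _.
rewrite (_ : a - b - (u - v) = (a - u) - (b - v)); last by ring.
by apply: le_trans (ler_normB _ _) _; apply: le_trans (lerD h1 h2) _; lra.
Qed.

Lemma rsummable_le f g : (forall i, `|f i| <= `|g i|) -> rsummable g -> rsummable f.
Proof.
by move=> fg; apply: le_lt_trans; apply: le_esum => i _; rewrite /= lee_fin.
Qed.

Lemma rsummableD f g : rsummable f -> rsummable g -> rsummable (fun i => f i + g i).
Proof. exact: summableD. Qed.

Lemma rsummable_norm f : rsummable f -> rsummable (fun i => `|f i|).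
Proof. by apply: rsummable_le => i; rewrite normr_id. Qed.

Lemma rsummableM f g (C : R) : (forall i, `|f i| <= C) -> rsummable g ->
  rsummable (fun i => f i * g i).
Proof.
(* A natural number bounding [C] reduces the claim to [n] additions of [g]. *)
move=> fC sg; have [n Cn] : exists n : nat, C <= n%:R.
  by exists (Num.truncn C).+1; exact/ltW/truncnS_gt.
apply: (@rsummable_le _ (fun i => g i *+ n)).
  by move=> i; rewrite normrM normrMn -mulr_natl ler_wpM2r// (le_trans (fC i)).
elim: n {Cn} => [|n IH].
  by apply: (@rsummable_le _ g) => // i; rewrite mulr0n normr0.
by under [X in rsummable X]funext do rewrite mulrS; exact: rsummableD.
Qed.

Lemma rsummableZ (k : R) f : rsummable f -> rsummable (fun i => k * f i).
Proof. exact: rsummableM (fun=> lexx `|k|). Qed.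

Lemma rsum_unique f (l : R) : rsummable f ->
  (forall e, 0 < e -> exists X : {fset T}, forall Y : {fset T}, (X `<=` Y)%fset ->
    `|\sum_(i <- Y) f i - l| <= e) -> rsum f = l.
Proof.
move=> sf fl; apply/eqP; rewrite -subr_eq0 -normr_le0; apply/ler_addgt0Pl => e e0.
have e20 : 0 < e / 2 by rewrite divr_gt0.
have [X HX] := rsum_approx sf e20; have [Y HY] := fl _ e20.
have := HX (X `|` Y)%fset (fsubsetUl _ _); have := HY (X `|` Y)%fset (fsubsetUr _ _).
set a := \sum_(i <- _) _ => al ar; rewrite addr0.
rewrite (_ : rsum f - l = (a - l) - (a - rsum f)); last by ring.
by apply: le_trans (ler_normB _ _) _; apply: le_trans (lerD al ar) _; lra.
Qed.

Lemma rsumD f g : rsummable f -> rsummable g ->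
  rsum (fun i => f i + g i) = rsum f + rsum g.
Proof.
move=> sf sg; apply: rsum_unique => [|e e0]; first exact: rsummableD.
have e20 : 0 < e / 2 by rewrite divr_gt0.
have [X HX] := rsum_approx sf e20; have [Y HY] := rsum_approx sg e20.
exists (X `|` Y)%fset => Z; rewrite fsubUset => /andP[/HX h1 /HY h2].
rewrite big_split/=; set a := \sum_(i <- Z) f i; set b := \sum_(i <- Z) g i.
rewrite (_ : a + b - _ = (a - rsum f) + (b - rsum g)); last by ring.
by apply: le_trans (ler_normD _ _) _; apply: le_trans (lerD h1 h2) _; lra.
Qed.

Lemma rsumZ (k : R) f : rsummable f -> rsum (fun i => k * f i) = k * rsum f.
Proof.
move=> sf; apply: rsum_unique => [|e e0]; first exact: rsummableZ.
have k0 : 0 < 1 + `|k| by rewrite ltr_pwDl.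
have [X HX] := rsum_approx sf (divr_gt0 e0 k0).
exists X => Z /HX; rewrite -mulr_sumr -mulrBr normrM ler_pdivlMr// => h.
by apply: le_trans h; rewrite mulrC ler_wpM2l// lerDr.
Qed.

Lemma rsum_fset (X : {fset T}) f : (forall i, i \notin X -> f i = 0) ->
  rsummable f /\ rsum f = \sum_(i <- X) f i.
Proof.
move=> f0; have sf : rsummable f.
  rewrite /rsummable /summable (esumID [set` X])//.
  rewrite [X in (_ + X)%E]esum1 ?adde0; last first.
    by move=> i [_ /= /negP iX]; rewrite f0 ?normr0.
  rewrite setTI esum_fset ?finite_fset// fsbig_finite ?finite_fset//=.
  by rewrite sumEFin ltry.
split=> //; apply: rsum_unique => // e e0; exists X => Y XY.
by rewrite -(big_fset_incl _ XY) ?subrr ?normr0 ?ltW// => i _; exact: f0.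
Qed.

Lemma ler_rsum f g : rsummable f -> rsummable g -> (forall i, f i <= g i) ->
  rsum f <= rsum g.
Proof.
move=> sf sg fg; apply/ler_addgt0Pl => e e0.
have e20 : 0 < e / 2 by rewrite divr_gt0.
have [X HX] := rsum_approx sf e20; have [Y HY] := rsum_approx sg e20.
have := HX (X `|` Y)%fset (fsubsetUl _ _); have := HY (X `|` Y)%fset (fsubsetUr _ _).
have : \sum_(i <- (X `|` Y)%fset) f i <= \sum_(i <- (X `|` Y)%fset) g i by exact: ler_sum.
by rewrite !ler_distl => h1 /andP[h2 h3] /andP[h4 h5]; lra.
Qed.

Lemma rsummable_sum (J : Type) (r : seq J) (P : pred J) (F : J -> T -> R) :
  (forall j, rsummable (F j)) ->
  rsummable (fun i => \sum_(j <- r | P j) F j i) /\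
  rsum (fun i => \sum_(j <- r | P j) F j i) = \sum_(j <- r | P j) rsum (F j).
Proof.
move=> sF; have z := @rsum_fset fset0 (fun=> 0) (fun i _ => erefl).
rewrite big_seq_fset0 in z.
elim: r => [|j r [IHs IH]].
  rewrite big_nil; have -> // : (fun i => \sum_(j <- [::] | P j) F j i) = (fun=> 0 : R).
  by apply/funext => i; rewrite big_nil.
have [Pj|Pj] := boolP (P j).
  have -> : (fun i => \sum_(j <- j :: r | P j) F j i) =
      (fun i => F j i + \sum_(j <- r | P j) F j i).
    by apply/funext => i; rewrite big_cons Pj.
  by split; [exact: rsummableD|rewrite rsumD// big_cons Pj IH].
have -> : (fun i => \sum_(j <- j :: r | P j) F j i) = (fun i => \sum_(j <- r | P j) F j i).
  by apply/funext => i; rewrite big_cons (negbTE Pj).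
by rewrite big_cons (negbTE Pj).
Qed.

Lemma fine_esum_norm f : fine (\esum_(i in [set: T]) `|f i|%:E) = rsum (fun i => `|f i|).
Proof.
rewrite /rsum [X in _ - fine X]esum1 ?subr0; last first.
  by move=> i _; rewrite max_r// oppr_le0.
by congr fine; apply: eq_esum => i _; rewrite max_l.
Qed.

End rsum.

(** Applied to [node], it turns sums over spikes into sums over the grid. *)
Lemma rsum_image (R : realType) (I T : choiceType) (e : I -> T) (f : T -> R) :
  injective e -> (forall j, ~ range e j -> f j = 0) -> rsum (f \o e) = rsum f.
Proof.
move=> einj f0.
have im (a : T -> \bar R) : (forall j, (0 <= a j)%E) -> (forall j, ~ range e j -> a j = 0%E) ->
    \esum_(i in [set: I]) a (e i) = \esum_(j in [set: T]) a j.
  move=> a0 az; rewrite (esumID (range e))// setTI.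
  rewrite [X in (_ + X)%E]esum1 ?adde0; last by move=> j [_ /= /az].
  by rewrite esum_image// => i j _ _; exact: einj.
rewrite /rsum /=; congr (fine _ - fine _).
- apply: (im (fun j => (Num.max (f j) 0)%:E)) => j; first by rewrite lee_fin le_max lexx orbT.
  by move=> /f0 ->; rewrite maxxx.
- apply: (im (fun j => (Num.max (- f j) 0)%:E)) => j; first by rewrite lee_fin le_max lexx orbT.
  by move=> /f0 ->; rewrite oppr0 maxxx.
Qed.

(** * Duality and recovery *)

Lemma l1norm_sum_inj_le (R : realType) (f : int -> R) (B : R) (J : finType)
    (K : J -> int) :
  injective K -> (l1norm f <= B%:E)%E -> \sum_j `|f (K j)| <= B.
Proof.
move=> Kinj fB; rewrite -lee_fin; apply: le_trans fB.
apply: le_trans (esum_fset_le (fun k => `|f k|) [fset K j | j in J]%fset).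
rewrite big_imfset/=; last by move=> i j _ _; exact: Kinj.
by rewrite big_enum.
Qed.

(** Bounding the three sums separately would give [2 * B]. For [w = r] and [w = - r] the points
    [K j] and [K j + w] are all distinct, so each pair of sums is at most [B]; averaging over the
    two choices of [w] gives [B]. *)
Lemma l1norm_shifts_le (R : realType) (f : int -> R) (B : R) (J : finType)
    (K : J -> int) (b : bool) (r : int) :
  injective K -> (l1norm f <= B%:E)%E -> 0 <= B ->
  (b -> r != 0 /\ forall i j, K i + r != K j) ->
  \sum_j (`|f (K j)| + b%:R / 2 * (`|f (K j - r)| + `|f (K j + r)|)) <= B.
Proof.
move=> Kinj fB B0 sepb; rewrite big_split/= -mulr_sumr big_split/=.
case: b sepb => [/(_ isT)[r0 sep]|_]; last first.
  by rewrite !mul0r addr0 l1norm_sum_inj_le.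
have pairs (w : int) : w = r \/ w = - r ->
    \sum_j `|f (K j)| + \sum_j `|f (K j + w)| <= B.
  move=> wr.
  pose K2 (p : J * bool) := if p.2 then K p.1 else K p.1 + w.
  have K2inj : injective K2.
    move=> [i []] [j []]; rewrite /K2/=.
    - by move=> /Kinj ->.
    - move=> E; case: wr => wr; [have := sep j i|have := sep i j]; rewrite E wr.
        by rewrite eqxx.
      by rewrite subrK eqxx.
    - move=> E; case: wr => wr; [have := sep i j|have := sep j i]; rewrite -E wr.
        by rewrite eqxx.
      by rewrite subrK eqxx.
    - by move=> /addIr /Kinj ->.
  have := l1norm_sum_inj_le K2inj fB.
  rewrite -(pair_bigA _ (fun j c => `|f (K2 (j, c))|))/=.
  by under eq_bigr do rewrite big_bool /=; rewrite big_split.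
have := pairs r (or_introl erefl); have := pairs (- r) (or_intror erefl).
by rewrite /=; move: (\sum_j _) (\sum_j _) (\sum_j _) => x y w; lra.
Qed.

(** Evenness turns a value of the convolution into the pairing of [z] with a translate of [g]
    centred at a grid point. *)
Lemma conv_sampledE (R : realType) (g : R -> R) (sigma N : R) (z : int -> R) (j : int) :
  (forall t, g (- t) = g t) ->
  Defs.conv (sampled g sigma N) z j =
  rsum (fun k : int => g (k%:~R * (sigma * N)^-1 - j%:~R * (sigma * N)^-1) * z k).
Proof.
move=> gN; rewrite /Defs.conv /sampled; congr rsum; apply/funext => k.
by rewrite -mulrBl -[in LHS]gN -mulNr -rmorphN/= opprB rmorphB.
Qed.

(** The pulses expand into grid translates of [g], so the pairing of [W] with [z] is a combination
    of values of [f]. The even pulses cost [al * B] thanks to the disjoint shifts, the two halves of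
    the odd pulses [be * B] each. *)
Lemma dual_bound (R : realType) (g : R -> R) (sigma N C B al be : R)
    (z : int -> R) (J : finType) (K : J -> int) (a c : J -> R) (b b' : bool)
    (r r' : nat) :
  let h := (sigma * N)^-1 in
  let W k := \sum_l a l * even_comb b (r%:R * h) g (k%:~R * h - (K l)%:~R * h) +
             \sum_l c l * odd_comb b' (r'%:R * h) g (k%:~R * h - (K l)%:~R * h) in
  (forall t, g (- t) = g t) -> (forall t, `|g t| <= C) -> rsummable z ->
  injective K -> 0 <= B -> (l1norm (Defs.conv (sampled g sigma N) z) <= B%:E)%E ->
  (b -> r%:Z != 0 /\ forall i j, K i + r%:Z != K j) ->
  0 <= al -> 0 <= be -> (forall l, `|a l| <= al) -> (forall l, `|c l| <= be) ->
  rsummable (fun k => W k * z k) /\ rsum (fun k => W k * z k) <= (al + 2 * be) * B.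
Proof.
move=> h W gN gC sz Kinj B0 fB sepb al0 be0 aal cbe.
pose phi (j k : int) := g (k%:~R * h - j%:~R * h) * z k.
pose f := Defs.conv (sampled g sigma N) z.
have sphi j : rsummable (phi j) by apply: rsummableM sz => k; exact: gC.
have rphi j : rsum (phi j) = f j by rewrite /f conv_sampledE.
pose F l k := a l * phi (K l) k + (- (a l * (b%:R / 2)) * phi (K l - r%:Z) k +
  (- (a l * (b%:R / 2)) * phi (K l + r%:Z) k +
  (c l * b'%:R * phi (K l + r'%:Z) k + - (c l * b'%:R) * phi (K l - r'%:Z) k))).
have WF : (fun k => W k * z k) = (fun k => \sum_l F l k).
  apply/funext => k; rewrite /W mulrDl !mulr_suml -big_split/=; apply: eq_bigr => l _.
  rewrite /even_comb /odd_comb /F /phi !rmorphB !rmorphD/= !mulrDl !mulNr.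
  rewrite !opprD !opprK !addrA; ring.
have sZ x j : rsummable (fun k => x * phi j k) := rsummableZ x (sphi j).
have FE l : rsummable (F l) /\ rsum (F l) =
    a l * f (K l) - a l * (b%:R / 2) * (f (K l - r%:Z) + f (K l + r%:Z)) +
    c l * b'%:R * (f (K l + r'%:Z) - f (K l - r'%:Z)).
  have s1 := sZ (a l) (K l).
  have s2 := sZ (- (a l * (b%:R / 2))) (K l - r%:Z).
  have s3 := sZ (- (a l * (b%:R / 2))) (K l + r%:Z).
  have s4 := sZ (c l * b'%:R) (K l + r'%:Z).
  have s5 := sZ (- (c l * b'%:R)) (K l - r'%:Z).
  have s45 := rsummableD s4 s5; have s345 := rsummableD s3 s45.
  have s2345 := rsummableD s2 s345.
  split; first exact: rsummableD s1 s2345.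
  have E : rsum (F l) = _ := rsumD s1 s2345.
  rewrite E (rsumD s2 s345) (rsumD s3 s45) (rsumD s4 s5) !rsumZ// !rphi; ring.
have sF l := (FE l).1; have rF l := (FE l).2.
have [sW rW] := rsummable_sum (index_enum J) xpredT sF.
rewrite WF; split=> //; rewrite rW.
pose u l := `|f (K l)| + b%:R / 2 * (`|f (K l - r%:Z)| + `|f (K l + r%:Z)|).
pose v l := `|f (K l + r'%:Z)|; pose v' l := `|f (K l - r'%:Z)|.
have Fle l : rsum (F l) <= al * u l + be * (v l + v' l).
  rewrite rF; have b0 : 0 <= b%:R / 2 :> R by rewrite divr_ge0.
  have abs (x y m : R) : `|x| <= m -> x * y <= m * `|y|.
    by move=> xm; apply: le_trans (ler_norm _) _; rewrite normrM ler_wpM2r.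
  have aN : `|- a l| <= al by rewrite normrN.
  have h1 := abs _ (f (K l)) _ (aal l).
  have h2 := ler_wpM2l b0 (abs _ (f (K l - r%:Z)) _ aN).
  have h3 := ler_wpM2l b0 (abs _ (f (K l + r%:Z)) _ aN).
  have cb : `|c l * b'%:R| <= be.
    by rewrite normrM normr_nat; case: (b') => /=; rewrite ?mulr1 ?mulr0.
  have cbN : `|- (c l * b'%:R)| <= be by rewrite normrN.
  have h4 := abs _ (f (K l + r'%:Z)) _ cb.
  have h5 := abs _ (f (K l - r'%:Z)) _ cbN.
  by rewrite /u /v /v'; move: h1 h2 h3 h4 h5; move: (b%:R / 2) => q; lra.
apply: le_trans (ler_sum _ (fun l _ => Fle l)) _.
have -> : \sum_l (al * u l + be * (v l + v' l)) =
    al * \sum_l u l + be * (\sum_l v l + \sum_l v' l).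
  by rewrite big_split -[X in be * X]big_split !mulr_sumr.
have shiftinj w : injective (fun l => K l + w) by move=> i j /addIr /Kinj.
have hu : \sum_l u l <= B := l1norm_shifts_le Kinj fB B0 sepb.
have hv : \sum_l v l <= B := l1norm_sum_inj_le (shiftinj r'%:Z) fB.
have hv' : \sum_l v' l <= B := l1norm_sum_inj_le (shiftinj (- r'%:Z)) fB.
have := ler_wpM2l al0 hu; have := ler_wpM2l be0 hv; have := ler_wpM2l be0 hv'.
lra.
Qed.

Lemma spikes_out (R : realType) (I : choiceType) (node : I -> int) (c : I -> R) (k : int) :
  ~ range node k -> spikes node c k = 0.
Proof.
move=> kout; have [|_] := @rsum_fset R I fset0 (fun m => c m * kronecker R (k - node m)).
  move=> m _; rewrite /kronecker subr_eq0; case: eqP => [km|_]; last by rewrite mulr0.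
  by case: kout; exists m.
by rewrite big_seq_fset0.
Qed.

Lemma spikes_node (R : realType) (I : choiceType) (node : I -> int) (c : I -> R) (m : I) :
  injective node -> spikes node c (node m) = c m.
Proof.
move=> ninj.
have [|_] := @rsum_fset R I [fset m]%fset (fun i => c i * kronecker R (node m - node i)).
  move=> i; rewrite inE /kronecker subr_eq0 => im.
  by case: eqP => [/ninj mi|_]; [rewrite mi eqxx in im|rewrite mulr0].
by rewrite /spikes => ->; rewrite big_seq_fset1 /kronecker subrr eqxx mulr1.
Qed.

Lemma measurementsE (R : realType) (g : R -> R) (sigma N : R) (I : choiceType)
    (node : I -> int) (c : I -> R) (eta : int -> R) (k : int) :
  injective node ->
  measurements g sigma N node c eta k =
  Defs.conv (sampled g sigma N) (spikes node c) k + eta k.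
Proof.
move=> ninj; congr +%R.
rewrite /Defs.conv -(rsum_image ninj); last first.
  by move=> j jout; rewrite spikes_out// mulr0.
by congr rsum; apply/funext => m /=; rewrite spikes_node// mulrC.
Qed.

(** Each smallness condition reads [e * T_i <= 1]. With [T] the sum of the four,
    [nu >= 16 * (C * T) + 1] gives [e * T <= 1], because [nu <= nu ^+ 2]. *)
Lemma separation_large (R : realType) (C d eps beta : R) :
  0 < C -> 0 < d -> 0 < eps -> 0 < beta ->
  exists nu1 : R, forall nu : R, nu1 <= nu ->
  let e := C * (16 / nu ^+ 2) in
  let kappa := 4 * C / d ^+ 2 * e in
  [/\ 0 < nu, 2 * eps <= nu, 4 * e <= d, kappa <= 1 / 12 &
      2 * kappa * C + 2 * e <= beta * eps ^+ 2 / 12 /\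
      kappa * C + 2 * e <= beta / 3].
Proof.
move=> C0 d0 e0 b0.
pose w := 4 * C / d ^+ 2; have w0 : 0 < w by rewrite divr_gt0 ?exprn_gt0// mulr_gt0.
pose T1 := 4 / d; pose T2 := w * 12; pose T3 := (2 * w * C + 2) * 12 / (beta * eps ^+ 2).
pose T4 := (w * C + 2) * 3 / beta.
have wC : 0 < w * C by rewrite mulr_gt0.
have be0 : 0 < beta * eps ^+ 2 by rewrite mulr_gt0// exprn_gt0.
have T10 : 0 < T1 by rewrite divr_gt0.
have T20 : 0 < T2 by rewrite mulr_gt0.
have T30 : 0 < T3 by rewrite divr_gt0//; lra.
have T40 : 0 < T4 by rewrite divr_gt0//; lra.
pose T := T1 + T2 + T3 + T4.
have T0 : 0 < T by rewrite /T; lra.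
have CT : 0 < C * T by rewrite mulr_gt0.
exists (16 * (C * T) + 1 + 2 * eps) => nu nu1 e kappa.
have nu0 : 0 < nu by lra.
have ee0 : 0 <= e by rewrite mulr_ge0 ?divr_ge0 ?sqr_ge0// ltW.
have eT : e * T <= 1.
  have -> : e * T = 16 * (C * T) / nu ^+ 2 by rewrite /e; ring.
  rewrite ler_pdivrMr ?exprn_gt0// mul1r.
  have : nu * 1 <= nu * nu by rewrite ler_wpM2l ?ltW//; lra.
  by rewrite expr2; lra.
have key x : 0 < x -> x <= T -> e * x <= 1.
  by move=> x0 xT; apply: le_trans eT; rewrite ler_wpM2l.
split=> //; first by lra.
- have : e * T1 <= 1 by apply: key => //; rewrite /T; lra.
  by rewrite /T1 mulrA ler_pdivrMr//; lra.
- have : e * T2 <= 1 by apply: key => //; rewrite /T; lra.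
  by rewrite /T2 /kappa -/w; lra.
split.
- have : e * T3 <= 1 by apply: key => //; rewrite /T; lra.
  by rewrite /T3 mulrA ler_pdivrMr// /kappa -/w; lra.
- have : e * T4 <= 1 by apply: key => //; rewrite /T; lra.
  by rewrite /T4 mulrA ler_pdivrMr// /kappa -/w; lra.
Qed.

Theorem theorem2p10 (R : realType) (g : R -> R) (eps beta : R)
    (hg : admissible g eps beta) :
  exists nu0 : R, Num.max eps beta < nu0 /\
  forall nu : R, nu0 <= nu ->
  forall sigma N delta : R, 0 < sigma -> 0 < N -> 0 <= delta ->
  forall (I : choiceType) (node : I -> int) (c : I -> R),
  injective node ->
  (forall i j : I, i != j ->
     N * nu * sigma <= (`|node i - node j| : int)%:~R) ->
  (forall m : I, c m != 0) ->
  in_l1 (spikes node c) ->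
  forall eta : int -> R, (l1norm eta <= delta%:E)%E ->
  forall xhat : int -> R,
  l1_solution (sampled g sigma N) (measurements g sigma N node c eta) delta
    xhat ->
  let gamma := Num.max (N * sigma) eps^-1 in
  let threshold := 16 * gamma ^+ 2 / beta * delta in
  forall m : I, threshold < `|c m| ->
  exists2 khat : int, supp xhat khat &
    (`|node m - khat| : int)%:~R <=
      8 * gamma ^+ 2 / beta *
      Num.sqrt (g 0 * delta / (`|c m| - threshold)).
Proof.
have [e0 b0 _ gN _ _ _ _] := hg.
have [C [d [Q [C0 d0 prof]]]] := kernel_profile hg.
have [g1 [g2 [Cg Cg0 [_ _ gC _ _]]]] := admissible_derive hg.
have gbd t : `|g t| <= Cg by exact: decay_bound (ltW Cg0) gC.
have [nu1 nu1P] := separation_large C0 d0 e0 b0.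
(* [Q] makes the separation exceed the shift of the side pulses; [nu1] provides the smallness
   conditions. *)
exists (1 + eps + beta + `|Q| + `|nu1|); split.
  have nQ := normr_ge0 Q; have nn := normr_ge0 nu1.
  by rewrite gt_max; apply/andP; split; lra.
move=> nu nule sigma N delta s0 N0 delta0 I node c ninj sep cn0 xl1 eta etad xhat.
set x := spikes node c in xl1 *; set hh := sampled g sigma N.
move=> [[xhl1 xhfeas] xhmin] gamma threshold m0 cthr.
have [nu0 nueps ed kap [sm1 sm2]] : [/\ 0 < nu, 2 * eps <= nu, 4 * (C * (16 / nu ^+ 2)) <= d,
    4 * C / d ^+ 2 * (C * (16 / nu ^+ 2)) <= 1 / 12 &
    2 * (4 * C / d ^+ 2 * (C * (16 / nu ^+ 2))) * C + 2 * (C * (16 / nu ^+ 2)) <= beta * eps ^+ 2 / 12 /\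
    4 * C / d ^+ 2 * (C * (16 / nu ^+ 2)) * C + 2 * (C * (16 / nu ^+ 2)) <= beta / 3].
  by apply: nu1P; have := ler_norm nu1; have := normr_ge0 Q; lra.
have Qnu : Q < nu by have := ler_norm Q; have := normr_ge0 nu1; lra.
(* A spike in the support is its own [khat]: the distance is [0] and the right-hand side is
   nonnegative. *)
suff xk0 : xhat (node m0) != 0.
  exists (node m0) => //; rewrite subrr normr0 mulr_ge0 ?sqrtr_ge0//.
  by rewrite divr_ge0 ?(ltW b0)// mulr_ge0// sqr_ge0.
set k0 := node m0; apply/eqP => xk0.
pose h := (sigma * N)^-1; have h0 : 0 < h by rewrite invr_gt0 mulr_gt0.
have [b [b' [r [r' [D [E [pr r0 rQ]]]]]]] := prof h h0.
set G := even_comb b _ g in pr; set H := odd_comb b' _ g in pr.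
pose A := G 0; pose rho := beta / (6 * gamma ^+ 2).
have gh : 1 <= gamma * h.
  by rewrite /gamma -ler_pdivrMr ?le_max /h ?div1r ?invrK ?invr_gt0 ?mulr_gt0// mulrC lexx.
have geps : 1 <= gamma * eps by rewrite -ler_pdivrMr// le_max div1r lexx orbT.
have gam0 : 0 < gamma by rewrite /gamma lt_max mulr_gt0.
have rho0 : 0 < rho by rewrite divr_gt0// mulr_gt0// exprn_gt0.
(* Used for [z = eps] and [z = h], the two entries of the maximum [gamma] being their inverses;
   [rho] is thus admissible in both zones of the certificate. *)
have rho_le z : 1 <= gamma * z -> rho <= beta * z ^+ 2 / 6.
  move=> gz; rewrite /rho ler_pdivrMr ?mulr_gt0 ?exprn_gt0//.
  have -> : beta * z ^+ 2 / 6 * (6 * gamma ^+ 2) = beta * (gamma * z) ^+ 2 by field.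
  by rewrite ler_peMr ?(ltW b0)// expr_ge1// (le_trans ler01 gz).
have peakA : beta * eps ^+ 2 / 2 <= A := profile_peak pr.
have be0 : 0 < beta * eps ^+ 2 by rewrite mulr_gt0// exprn_gt0.
have rhoA : rho <= A by have := rho_le eps geps; lra.
have gap : 5 / 2 * delta < rho * `|c m0|.
  have : rho * threshold < rho * `|c m0| by rewrite ltr_pM2l.
  have -> : rho * threshold = 8 / 3 * delta.
    by rewrite /rho /threshold; field; rewrite !gt_eqF.
  by lra.
(* The mass allowed off [F], chosen so that the final error [2 * A * tail] is half the gap. *)
pose tail := (rho * `|c m0| - 5 / 2 * delta) / (4 * A).
have A0 : 0 < A by lra.
have tail0 : 0 < tail by rewrite divr_gt0 ?subr_gt0 ?mulr_gt0.
have sx : rsummable x := xl1.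
have sxh : rsummable xhat := xhl1.
have [X HX] := rsum_approx (rsummable_norm sx) tail0.
(* Discarding the zeros of [x] leaves only spike locations, which are separated. *)
pose F := [fset k in (k0 |` X)%fset | x k != 0]%fset.
have xk : x k0 = c m0 by exact: spikes_node.
have k0F : k0 \in F by rewrite !inE eqxx xk cn0.
pose z k := xhat k - x k.
have zE : z = (fun k => xhat k + -1 * x k) by apply/funext => k; rewrite mulN1r.
have sz : rsummable z by rewrite zE; exact: rsummableD sxh (rsummableZ (-1) sx).
pose K (j : F) : int := fsval j.
pose t (j : F) : R := (K j)%:~R * h.
(* The sign at [0] is taken to be [1], so that [|s j| = 1] throughout. *)
pose s (j : F) : R := if 0 <= z (K j) then 1 else -1.
have Krange j : exists m, node m = K j.
  have : x (K j) != 0 by have := fsvalP j; rewrite !inE => /andP[].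
  apply: contraNP => nom; rewrite /x spikes_out// => -[m _ mE].
  by apply: nom; exists m.
have Ksep i j : i != j -> nu <= `|t i - t j|.
  move=> ij; have [mi miE] := Krange i; have [mj mjE] := Krange j.
  have mij : mi != mj.
    by apply: contra ij => /eqP mm; apply/eqP/val_inj; rewrite /= -/(K i) -/(K j) -miE -mjE mm.
  rewrite /t -mulrBl normrM (gtr0_norm h0) -ler_pdivrMr// /h invrK -rmorphB/= -intr_norm.
  by have := sep _ _ mij; rewrite miE mjE; lra.
have s1 i : `|s i| = 1 by rewrite /s; case: ifP => _; rewrite ?normrN normr1.
have [a [q [aB qB Wt Woff]]] := certificate pr e0 b0 h0 (ltW C0) d0 nu0 nueps ed kap sm1 sm2
  (rho_le eps geps) (fun _ => rho_le h gh) Ksep s1.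
have Kinj : injective K by move=> i j /val_inj.
have hhbd k : `|hh k| <= Cg by exact: gbd.
have sconv u k : rsummable u -> rsummable (fun j => hh (k - j) * u j).
  by move=> su; apply: rsummableM su => j; exact: hhbd.
have convz k : Defs.conv hh z k = Defs.conv hh xhat k - Defs.conv hh x k.
  have := rsumD (sconv _ k sxh) (rsummableZ (-1) (sconv _ k sx)).
  rewrite rsumZ; last exact: sconv.
  rewrite mulN1r /Defs.conv => <-; congr rsum; apply/funext => j.
  by rewrite /z; ring.
(* The residuals of [x] and [xhat] each have norm at most [delta], and [z] is the difference of the
   two signals. *)
have zfeas : (l1norm (Defs.conv hh z) <= (2 * delta)%:E)%E.
  have -> : (2 * delta)%:E = (delta%:E + delta%:E)%E by rewrite -EFinD mulr_natl mulr2n.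
  apply: le_trans (leeD etad xhfeas); rewrite /l1norm -esumD; last 2 first.
  - by move=> k _; rewrite lee_fin.
  - by move=> k _; rewrite lee_fin.
  apply: le_esum => k _; rewrite -EFinD lee_fin measurementsE// convz -/x -/hh.
  apply: le_trans (ler_normB _ _); rewrite le_eqVlt; apply/orP; left.
  by apply/eqP; congr `|_|; ring.
(* [x] is feasible, its residual being [eta], so minimality of [xhat] applies. *)
have normle : rsum (fun k => `|xhat k|) <= rsum (fun k => `|x k|).
  rewrite -!fine_esum_norm; apply: fine_le.
  - by have := sxh; rewrite /rsummable summableE.
  - by have := sx; rewrite /rsummable summableE.
  apply: xhmin; split=> //; apply: le_trans etad; apply: le_esum => k _.
  by rewrite measurementsE// addrC addKr.
have bsep : b -> r%:Z != 0 /\ forall i j, K i + r%:Z != K j.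
  move=> bT; have rgt := r0 bT; split; first by rewrite eqz_nat -lt0n.
  move=> i j; apply/eqP => Kij.
  have ij : j != i.
    by apply: contraTneq rgt => ji; move: Kij; rewrite ji => /eqP; rewrite -subr_eq0 addrC addKr eqz_nat -leqn0 -leqNgt.
  have := Ksep _ _ ij; rewrite /t -Kij rmorphD/= mulrDl addrC addKr.
  by rewrite ger0_norm ?mulr_ge0 ?(ltW h0)//; have := rQ bT; lra.
have al0 : 0 <= 1 + 1 / 12 :> R by lra.
have be0' : 0 <= 1 / 12 :> R by lra.
have d20 : 0 <= 2 * delta by lra.
pose W u := \sum_l a l * G (u - t l) + \sum_l q l * H (u - t l).
(* The constant [(1 + 1 / 12 + 2 * (1 / 12)) * 2] is [5 / 2], below the [8 / 3] secured by the
   threshold. *)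
have [sW rW] : rsummable (fun k : int => W (k%:~R * h) * z k) /\
    rsum (fun k : int => W (k%:~R * h) * z k) <= (1 + 1 / 12 + 2 * (1 / 12)) * (2 * delta).
  exact: (@dual_bound R g sigma N Cg (2 * delta) _ _ z F K a q b b' r r' gN gbd sz Kinj d20 zfeas bsep al0 be0' aB qB).
pose v1 k := if k == k0 then rho * `|c m0| else 0.
pose w k := if k \in F then 0 else `|x k|.
have [sv1 rv1] : rsummable v1 /\ rsum v1 = rho * `|c m0|.
  have [|s_ r_] := @rsum_fset R int [fset k0]%fset v1.
    by move=> k; rewrite inE /v1 => /negbTE ->.
  by rewrite r_ big_seq_fset1 /v1 eqxx.
have [sw rw] : rsummable w /\ rsum w <= tail.
  pose wF k := if k \in F then `|x k| else 0.
  have [|sF rF] := @rsum_fset R int F wF; first by move=> k /negbTE kF; rewrite /wF kF.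
  have wE : w = (fun k => `|x k| + -1 * wF k).
    by apply/funext => k; rewrite /w /wF; case: ifP => _; ring.
  have sx' := rsummable_norm sx; have sF' := rsummableZ (-1) sF.
  rewrite wE; split; first exact: rsummableD.
  rewrite rsumD// rsumZ// rF.
  have -> : \sum_(k <- F) wF k = \sum_(k <- (k0 |` X)%fset) `|x k|.
    have FX : (F `<=` k0 |` X)%fset by apply/fsubsetP => k; rewrite !inE => /andP[].
    rewrite -(big_fset_incl _ FX) /=.
      by rewrite !big_seq; apply: eq_bigr => k kF; rewrite /wF kF.
    move=> k kX; rewrite !inE /= negb_and negbK; move: kX; rewrite !inE => -> /=.
    by move=> /eqP ->; rewrite normr0.
  by have := HX _ (fsubsetU1 k0 X); rewrite ler_distl => /andP[]; lra.
have rhoA0 : 0 <= A - rho by rewrite subr_ge0.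
have pointwise k : v1 k + (- (2 * (A - rho))) * w k <=
    W (k%:~R * h) * z k + (A - rho) * (`|xhat k| + -1 * `|x k|).
  have xhE : xhat k = x k + z k by rewrite /z; ring.
  (* Off [F], [|W| <= A - rho] and [|xhat| >= |z| - |x|]. On [F], [W z = A |z|] and
     [|xhat| >= |x| - |z|], which leaves [rho |z|]; at [k0] this is [rho * |c m0|] because
     [xhat k0 = 0]. *)
  rewrite mulN1r /w; case: ifPn => [kF|kF]; rewrite /v1; last first.
    case: eqP => [kk|_]; first by rewrite kk k0F in kF.
    have Wk : `|W (k%:~R * h)| <= A - rho.
      apply: Woff => m; exists (k - K m); last by rewrite rmorphB/= mulrBl.
      by rewrite subr_eq0; apply: contraNneq kF => ->; exact: fsvalP.
    have h1 : `|W (k%:~R * h) * z k| <= (A - rho) * `|z k|.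
      by rewrite normrM ler_wpM2r.
    have h2 : `|z k| - `|x k| <= `|xhat k|.
      by rewrite xhE; have := lerB_normD (z k) (x k); rewrite [z k + _]addrC.
    have := ler_wpM2l rhoA0 h2; have := ler_norm (- (W (k%:~R * h) * z k)).
    by rewrite normrN; lra.
  have -> : W (k%:~R * h) * z k = A * `|z k|.
    have := Wt [` kF]%fset; rewrite -/(W _) /t /K/= => ->; rewrite /s /K/= -/A.
    by case: (ger0P (z k)) => zk; ring.
  have h2 : `|x k| - `|z k| <= `|xhat k| by rewrite xhE; exact: lerB_normD.
  have h3 : (if k == k0 then rho * `|c m0| else 0) <= rho * `|z k|.
    case: eqP => [->|_]; last by rewrite mulr_ge0// ltW.
    by rewrite /z xk0 sub0r normrN xk.
  by have := ler_wpM2l rhoA0 h2; lra.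
have sxn := rsummable_norm sx; have sxhn := rsummable_norm sxh.
have s3 := rsummableD sxhn (rsummableZ (-1) sxn).
have s4 := rsummableZ (A - rho) s3.
have s5 := rsummableZ (- (2 * (A - rho))) sw.
have := ler_rsum (rsummableD sv1 s5) (rsummableD sW s4) pointwise.
rewrite (rsumD sv1 s5) (rsumD sW s4) (rsumZ _ sw) (rsumZ _ s3).
rewrite (rsumD sxhn (rsummableZ (-1) sxn)) (rsumZ _ sxn) rv1.
have := ler_wpM2l rhoA0 rw.
have : (A - rho) * (rsum (fun k => `|xhat k|) + -1 * rsum (fun k => `|x k|)) <= 0.
  by rewrite mulr_ge0_le0//; lra.
(* The tail absorbs at most half of the positive gap [rho * |c m0| - 5 / 2 * delta], while the
   summed inequality would require it to absorb all of it. *)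
have : (A - rho) * tail <= A * tail by rewrite ler_wpM2r ?(ltW tail0)//; lra.
have : A * tail = (rho * `|c m0| - 5 / 2 * delta) / 4.
  by rewrite /tail; field; rewrite gt_eqF.
by lra.
Qed.
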